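(* Let $n>1$ and equip $T^*\mathbb{CP}^{n-1}$ with Calabi's hyperkähler metric, realized as the metric $g$ on rank-1 projections described in the context. There is an $SU(n)\times\mathbb{Z}/2\mathbb{Z}\times\mathbb{Z}/2\mathbb{Z}$-equivariant isometric embedding $$T^*\mathbb{CP}^{n-1}\times\{0,1\}\hookrightarrow \mathbb{R}^{(n^2+1)^2}$$ (with $\mathbb{R}^{(n^2+1)^2}$ carrying its Euclidean metric) whose image is a real affine variety, i.e. the common zero set of finitely many real polynomials.
   Context: A point of $T^*\mathbb{CP}^{n-1}$ is identified with a pair $(V,f)$, where $V\subset\mathbb{C}^n$ is a $1$-dimensional subspace and $f\in\mathrm{Hom}(V^\perp,V)$. The manifold $\mathbb{C}\mathds{1}^{n-1}=\{q\in M_n(\mathbb{C}): q^2=q,\ \mathrm{rank}(q)=1\}$ is identified with $T^*\mathbb{CP}^{n-1}$ by $q\mapsto(\mathrm{im}(q),q|_{\mathrm{im}(q)^\perp})$. Its tangent space at $q$ is $\{a\in M_n(\mathbb{C}): qa+aq=a\}$. With $\|q\|=\sqrt{\mathrm{Tr}(q^\dagger q)}$ ($\dagger$ the conjugate transpose), the metric is $$g_q(a,b)=\mathrm{Re}\Big(\frac{2}{\|q\|}\mathrm{Tr}(ab^\dagger)-\frac{1}{\|q\|^{3}}\mathrm{Tr}(aq^\dagger)\mathrm{Tr}(qb^\dagger)\Big),$$ which is Calabi's hyperkähler metric (in this normalization). The product with $\{0,1\}$ is the disjoint union of two copies. Actions on the source: $U\in SU(n)$ acts by $q\mapsto UqU^{\dagger}$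 (this corresponds to the action induced from $SU(n)$ acting on $\mathbb{CP}^{n-1}$); the generator of the first $\mathbb{Z}/2\mathbb{Z}$ acts by the isometry $q\mapsto q^\dagger$; the generator of the second $\mathbb{Z}/2\mathbb{Z}$ exchanges the two elements of $\{0,1\}$. Target: let $\mathrm{Herm}(n^2)$ be the self-adjoint operators on the Hilbert space $M_n(\mathbb{C})$ (with Hilbert–Schmidt inner product). $\mathbb{R}^{(n^2+1)^2}$ is identified isometrically with $\mathbb{R}\oplus M_n(\mathbb{C})\oplus\mathrm{Herm}(n^2)$ with the inner product $\frac52 g_0\oplus g_1\oplus\frac12 g_2$, where $g_0,g_1,g_2$ are the standard real (Hilbert–Schmidt) inner products on the three summands. The group acts on it by linear isometries: $U\in SU(n)$ acts by $(x,q,p)\mapsto(x,UqU^\dagger,\mathrm{Ad}_U\,p\,\mathrm{Ad}_U^{-1})$ with $\mathrm{Ad}_U(T)=UTU^\dagger$; the first $\mathbb{Z}/2\mathbb{Z}$ acts by $(x,q,p)\mapsto(x,q^\dagger,p')$ with $p'(T)=p(T^\dagger)^\dagger$; the second acts by $(x,q,p)\mapsto(-x,-q,-p)$. *)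

(* Defs.v *)
From HB Require Import structures.
From mathcomp Require Import all_boot all_order all_algebra.
From mathcomp Require Import sesquilinear spectral.
From mathcomp Require Import all_classical all_reals all_analysis.
From mathcomp Require Import complex.
From mathcomp Require mpoly.

Set Implicit Arguments.
Unset Strict Implicit.
Unset Printing Implicit Defensive.

Import Order.TTheory GRing.Theory Num.Theory.
Import numFieldNormedType.Exports.
Local Open Scope sesquilinear_scope.
Local Open Scope classical_set_scope.
Local Open Scope ring_scope.

Section Smooth.
Variables (R : realType) (V W : normedModType R).

(* For finite-dimensional V (the only case used) this is the usual class C^k. *)
Fixpoint Ck (k : nat) (U : set V) (f : V -> W) : Prop :=
  match k with
  | 0 => forall x, U x -> {for x, continuous f}
  | k'.+1 => (forall x, U x -> differentiable f x) /\
             forall v : V, Ck k' U (fun x => 'd f x v)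
  end.

Definition smooth (U : set V) (f : V -> W) : Prop := forall k, Ck k U f.

Definition smooth_extension (X : set V) (f : V -> W) (x : V) (G : V -> W)
    : Prop :=
  exists U : set V,
    [/\ open U, U x, smooth U G & forall y, U y -> X y -> G y = f y].

Definition smooth_on (X : set V) (f : V -> W) : Prop :=
  forall x, X x -> exists G, smooth_extension X f x G.

End Smooth.

Definition real_affine_variety (R : realType) (N : nat) (A : set 'rV[R]_N)
    : Prop :=
  exists (k : nat) (p : 'I_k -> mpoly.mpoly N R),
    A = [set y | forall j, mpoly.meval (fun i => y ord0 i) (p j) = 0].

Definition euclid_dot (R : realType) (N : nat) (x y : 'rV[R]_N) : R :=
  \sum_i x ord0 i * y ord0 i.

Section RankOneProjections.
Variables (R : realType) (n : nat).
Local Notation M := 'M[R[i]]_n.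

Definition hs (A B : M) : R[i] := \tr (A *m B ^t*).

Definition hs_norm (q : M) : R := Num.sqrt (complex.Re (\tr (q ^t* *m q))).

Definition rank1_proj : set M := [set q | q *m q = q /\ \rank q = 1%N].

Definition tangent (q : M) : set M := [set a | q *m a + a *m q = a].

Definition calabi_metric (q a b : M) : R :=
  complex.Re ((2%:R / hs_norm q)%:C%C * hs a b
              - ((hs_norm q ^+ 3)^-1)%:C%C * hs a q * hs q b).

Definition source : set (M * bool) := rank1_proj `*` [set: bool].

(* M carries no real normed-module structure in the library, so topology and
   calculus on M are expressed in its real coordinates: real and imaginary
   parts of the entries. *)
Definition to_real (q : M) : 'M[R]_n * 'M[R]_n :=
  (map_mx (@complex.Re R) q, map_mx (@complex.Im R) q).

Definition of_real (z : 'M[R]_n * 'M[R]_n) : M :=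
  \matrix_(i, j) (z.1 i j +i* z.2 i j)%C.

Definition rank1_real : set ('M[R]_n * 'M[R]_n) := to_real @` rank1_proj.

Definition sheet (N : nat) (F : M * bool -> 'rV[R]_N) (s : bool)
  : 'M[R]_n * 'M[R]_n -> 'rV[R]_N := fun z => F (of_real z, s).

(* For a smooth F, the differential at q in a tangent direction a is the value
   ['d G (to_real q) (to_real a)] for any local smooth extension G; it does not
   depend on G, and G exists by smoothness. *)
Definition immersive (N : nat) (F : M * bool -> 'rV[R]_N) : Prop :=
  forall q s G, rank1_proj q ->
    smooth_extension rank1_real (sheet F s) (to_real q) G ->
    forall a, tangent q a -> 'd G (to_real q) (to_real a) = 0 -> a = 0.

(* The values of F outside [source] are irrelevant; the last clause says that
   the inverse of F is continuous on its image. *)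
Definition smooth_embedding (N : nat) (F : M * bool -> 'rV[R]_N) : Prop :=
  [/\ forall s, smooth_on rank1_real (sheet F s),
      immersive F,
      set_inj source F &
      exists g : 'rV[R]_N -> ('M[R]_n * 'M[R]_n) * bool,
        (forall q s, rank1_proj q -> g (F (q, s)) = (to_real q, s)) /\
        {within F @` source, continuous g}].

Definition isometric (N : nat) (F : M * bool -> 'rV[R]_N) : Prop :=
  forall q s G, rank1_proj q ->
    smooth_extension rank1_real (sheet F s) (to_real q) G ->
    forall a b, tangent q a -> tangent q b ->
      euclid_dot ('d G (to_real q) (to_real a)) ('d G (to_real q) (to_real b))
      = calabi_metric q a b.

(* R (+) M_n(C) (+) End(M_n(C)); the summand Herm(n^2) is cut out of End(M_n(C))
   by [selfadjoint], see [isometric_identification]. *)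
Definition target : Type := (R * M * 'End(M))%type.

Definition selfadjoint (p : 'End(M)) : Prop :=
  forall A B : M, hs (p A) B = hs A (p B).

(* Tr (p p'^* ), computed in the orthonormal basis of matrix units of M. *)
Definition hs_op (p p' : 'End(M)) : R[i] :=
  \sum_(i < n) \sum_(j < n) hs (p (delta_mx i j)) (p' (delta_mx i j)).

Definition target_dot (t t' : target) : R :=
  5%:R / 2%:R * (t.1.1 * t'.1.1)
  + complex.Re (hs t.1.2 t'.1.2)
  + 2%:R^-1 * complex.Re (hs_op t.2 t'.2).

(* Injectivity of L follows from preservation of the inner product. *)
Definition isometric_identification (N : nat) (L : 'rV[R]_N -> target)
    : Prop :=
  [/\ forall x y, L (x + y) =
        ((L x).1.1 + (L y).1.1, (L x).1.2 + (L y).1.2, (L x).2 + (L y).2),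
      forall (c : R) x, L (c *: x) =
        (c * (L x).1.1, c%:C%C *: (L x).1.2, c%:C%C *: (L x).2),
      range L = [set t | selfadjoint t.2] &
      forall x y, target_dot (L x) (L y) = euclid_dot x y].

Definition SU : set M := [set U | U \is unitarymx /\ \det U = 1].

Definition Ad (U : M) : 'End(M) := linfun (fun T : M => U *m T *m U ^t*).

Definition op_dagger (p : 'End(M)) : 'End(M) :=
  linfun (fun T : M => (p (T ^t*)) ^t*).

(* Action of (U, e1, e2) in SU(n) x Z/2 x Z/2, the factors Z/2 being [bool]
   with generator [true]; the three actions commute. *)
Definition act_source (U : M) (e1 e2 : bool) (z : M * bool) : M * bool :=
  let q := if e1 then z.1 ^t* else z.1 in
  (U *m q *m U ^t*, z.2 (+) e2).

Definition act_target (U : M) (e1 e2 : bool) (t : target) : target :=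
  let: (x, q, p) := if e1 then (t.1.1, t.1.2 ^t*, op_dagger t.2) else t in
  let: (x, q, p) := (x, U *m q *m U ^t*, (Ad U \o p \o (Ad U)^-1)%VF) in
  if e2 then (- x, - q, - p) else (x, q, p).

Definition equivariant (N : nat) (L : 'rV[R]_N -> target)
    (F : M * bool -> 'rV[R]_N) : Prop :=
  forall U e1 e2 z, SU U -> source z ->
    L (F (act_source U e1 e2 z)) = act_target U e1 e2 (L (F z)).

End RankOneProjections.

(* Main.v *)
Require Import Defs.
From HB Require Import structures.
From mathcomp Require Import all_boot all_order all_algebra.
From mathcomp Require Import sesquilinear spectral.
From mathcomp Require Import all_classical all_reals all_analysis complex.
From mathcomp Require Import ring lra.
From mathcomp Require mpoly.

(** Write r = ||q|| for a rank-one projection q, and |q><q| for the operator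
    T |-> Tr(T q^* ) q.  The embedding is

      (q, s) |-> (-1)^s (r^(1/2), r^(-1/2) q, r^(-3/2) |q><q|),

    a map that is homogeneous of degree 1/2 in q up to the sign.

    Isometry.  In a direction a, with r' the derivative of r, so that
    r r' = Re Tr(a q^* ), the three components of the differential contribute
    to the target norm, with their weights 5/2, 1 and 1/2, respectively
      (5/8) r'^2 / r,
      |a|^2 / r - (3/4) r'^2 / r,
      |a|^2 / r - |Tr(a q^* )|^2 / r^3 + (1/8) r'^2 / r.
    The terms in r'^2 cancel and the sum is Calabi's metric; the weight 5/2 is
    the one that makes this happen.  The identity [calabi_isometry] is the
    polarized form; it holds at every nonzero matrix and for all directions,
    because the same formula defines a smooth map on nonzero matrices.  What is
    specific to the projections is that a smooth extension of the embedding
    has a prescribed differential on tangent vectors ([extension_diff]).  This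
    needs curves of projections in every tangent direction, and lines suffice:
    a tangent vector satisfies a = q a + a q, and both q + t (q a) and
    q + t (a q) are rank-one projections for all t.

    Image.  A point (x, b, p) of the image has x b = q, so x b is idempotent of
    trace 1, |b|^2 = x^2 and x p = |b><b|.  Conversely these polynomial
    equations force x to be nonzero; then q = x b is a rank-one projection, its
    norm is x^2, and (x, b, p) is the image of q in the copy given by the sign
    of x ([image_embedE]).  The same formulas, q = x b and the sign of x, give
    the inverse of the embedding, which is continuous where x is nonzero.

    Equivariance holds because r is invariant under conjugation by unitary
    matrices and under the adjoint, and |q><q| is transported by them in the
    way the target prescribes.

    The identification of the Euclidean space with the target rests on the
    isometry between Hermitian and real matrices that adds the real and the
    imaginary part ([unherm_dot]). *)

Import Order.TTheory GRing.Theory Num.Theory.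
Import numFieldNormedType.Exports.
Set Implicit Arguments.
Unset Strict Implicit.
Unset Printing Implicit Defensive.
Local Open Scope classical_set_scope.
Local Open Scope ring_scope.

(** * Calculus of C^k maps on an open set *)

Section SmoothMaps.
Variables (R : realType) (V W : normedModType R).
Implicit Types (U : set V) (f g : V -> W) (c d : V -> R).

Lemma scale_bilinear (X : normedModType R) :
  bilinear_for (GRing.Scale.Law.clone _ _ *:%R _)
    (GRing.Scale.Law.clone _ _ *:%R _) (@GRing.scale R X).
Proof.
split=> [u|u] a x y /=.
- by rewrite scalerDl scalerA.
- by rewrite scalerDr !scalerA [u * a]mulrC.
Qed.
HB.instance Definition _ (X : normedModType R) :=
  bilinear_isBilinear.Build R R X X _ _ (@GRing.scale R X) (scale_bilinear X).

Lemma is_diff_scale c f dc df x : is_diff x c dc -> is_diff x f df ->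
  is_diff x (fun z => c z *: f z) (fun h => c x *: df h + dc h *: f x).
Proof.
move=> hc hf.
have sc : continuous (fun p : R * W => p.1 *: p.2).
  by move=> p; exact: scale_continuous.
have hs : is_diff (c x, f x) (fun p : R * W => p.1 *: p.2)
    (fun q => c x *: q.2 + q.1 *: f x).
  apply: DiffDef; first exact: (@differentiable_bilin _ _ _ _ *:%R).
  exact: (@diff_bilin _ _ _ _ *:%R).
exact: (is_diff_comp (is_diff_pair hc hf) hs).
Qed.

Lemma near_is_diff (x : V) f g df :
  (\near x, f x = g x) -> is_diff x f df -> is_diff x g df.
Proof.
move=> fg [/diff_locallyP [cf ef] dfE].
have gx : f x = g x by exact: nbhs_singleton fg.
have eg : g \o shift x = cst (g x) + 'd f x +o_ 0 id.
  apply/eqaddoP => _/posnumP[e].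
  have /eqaddoP /(_ _ (gt0 e)) small := ef; near=> y.
  have -> : (g \o shift x - (cst (g x) + 'd f x)) y
     = (f \o shift x - (cst (f x) + 'd f x)) y.
    rewrite !fctE /= gx; congr (_ - _); apply/esym; near: y.
    by have := fg; rewrite (near_shift 0) subr0.
  by near: y.
rewrite -dfE; apply: DiffDef; last exact: diff_unique.
by apply/diff_locallyP; rewrite (diff_unique cf eg).
Unshelve. all: by end_near. Qed.

Lemma is_diffE f df x h : is_diff x f df -> 'd f x h = df h.
Proof. by move=> hf; rewrite diff_val. Qed.

Lemma differentiable_ext U f g x : open U -> U x ->
  (forall y, U y -> f y = g y) -> differentiable f x ->
  differentiable g x /\ 'd f x = 'd g x :> (V -> W).
Proof.
move=> oU Ux fg /differentiableP df.
have nfg : \near x, f x = g x.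
  by apply: filterS (open_nbhs_nbhs (conj oU Ux)).
have dg := near_is_diff nfg df.
by split; [exact: ex_diff | rewrite [RHS]diff_val].
Qed.

End SmoothMaps.

Section Ck.
Variables (R : realType) (V : normedModType R) (U : set V).
Hypothesis oU : open U.
Implicit Types (W : normedModType R) (k : nat).

Lemma Ck_ext W k (f g : V -> W) : (forall y, U y -> f y = g y) ->
  Ck k U f -> Ck k U g.
Proof.
elim: k f g => [|k IHk] f g fg /=.
  move=> cf x Ux; suff: g y @[y --> x] --> g x by [].
  rewrite -(fg x Ux); apply: cvg_trans (cf x Ux); apply: near_eq_cvg.
  by apply: filterS (open_nbhs_nbhs (conj oU Ux)) => y /fg.
move=> [df dkf]; split=> [x Ux|v].
  by have [] := differentiable_ext oU Ux fg (df x Ux).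
apply: IHk (dkf v) => y Uy.
by have [_ ->] := differentiable_ext oU Uy fg (df y Uy).
Qed.

Lemma Ck_weaken W k (f : V -> W) : Ck k.+1 U f -> Ck k U f.
Proof.
elim: k f => [|k IHk] f [df dkf] /=.
  by move=> x Ux; apply: differentiable_continuous; exact: df.
by split=> // v; apply: IHk.
Qed.

(** A derivative that has been computed on [U] gives the induction step of a
    regularity proof. *)
Lemma CkS W k (f : V -> W) (df : V -> V -> W) :
  (forall x, U x -> is_diff x f (df x)) ->
  (forall v, Ck k U (df^~ v)) -> Ck k.+1 U f.
Proof.
move=> hf hdf; split=> [x Ux|v]; first by have := hf x Ux => ?; exact: ex_diff.
apply: Ck_ext (hdf v) => y Uy; apply/esym/is_diffE; exact: hf.
Qed.

Lemma Ck_cst W k (a : W) : Ck k U (cst a).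
Proof.
elim: k a => [|k IHk] a; first by move=> x _; exact: cst_continuous.
apply: (@CkS _ _ _ (fun=> 0)) => v; exact: (IHk 0).
Qed.

Lemma Ck_linear W k (f : {linear V -> W}) : continuous f -> Ck k U f.
Proof.
move=> cf; case: k => [|k]; first by move=> x _; exact: cf.
apply: (@CkS _ _ _ (fun=> f)) => [x _|v]; last exact: Ck_cst.
apply: DiffDef; [exact: linear_differentiable | exact: diff_lin].
Qed.

Lemma CkD W k (f g : V -> W) : Ck k U f -> Ck k U g ->
  Ck k U (fun z => f z + g z).
Proof.
elim: k f g => [|k IHk] f g.
  by move=> cf cg x Ux; apply: cvgD; [exact: cf | exact: cg].
move=> [df dkf] [dg dkg].
apply: (@CkS _ _ _ (fun x h => 'd f x h + 'd g x h)) => [x Ux|v].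
  exact: is_diffD (differentiableP (df x Ux)) (differentiableP (dg x Ux)).
exact: IHk (dkf v) (dkg v).
Qed.

Lemma CkZ W k (c : V -> R) (f : V -> W) : Ck k U c -> Ck k U f ->
  Ck k U (fun z => c z *: f z).
Proof.
elim: k c f => [|k IHk] c f.
  by move=> cc cf x Ux; apply: cvgZ; [exact: cc | exact: cf].
move=> hc hf; have [dc dkc] := hc; have [df dkf] := hf.
apply: (@CkS _ _ _ (fun x h => c x *: 'd f x h + 'd c x h *: f x)) => [x Ux|v].
  exact: is_diff_scale (differentiableP (dc x Ux)) (differentiableP (df x Ux)).
apply: CkD; first exact: IHk (Ck_weaken hc) (dkf v).
exact: IHk (dkc v) (Ck_weaken hf).
Qed.

Lemma CkX k (c : V -> R) m : Ck k U c -> Ck k U (fun z => c z ^+ m).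
Proof.
move=> hc; elim: m => [|m IHm]; first exact: Ck_cst.
by apply: Ck_ext (CkZ hc IHm) => y _; rewrite exprS.
Qed.

Lemma Ck_sum W k (I : Type) (r : seq I) (P : pred I) (f : I -> V -> W) :
  (forall i, Ck k U (f i)) -> Ck k U (fun z => \sum_(i <- r | P i) f i z).
Proof.
move=> hf; elim: r => [|i r IHr].
  by apply: Ck_ext (Ck_cst k 0) => y _; rewrite big_nil.
case Pi: (P i); last by apply: Ck_ext IHr => y _; rewrite big_cons Pi.
by apply: Ck_ext (CkD (hf i) IHr) => y _; rewrite big_cons Pi.
Qed.

End Ck.

(** * Hilbert-Schmidt products and rank-one operators *)

Section HilbertSchmidt.
Variables (R : realType) (n : nat).
Local Notation C := R[i].
Local Notation M := 'M[C]_n.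
Local Notation Re := (@complex.Re R).
Local Notation Im := (@complex.Im R).
Implicit Types (a b c d q : M) (x y : C).

Lemma ReD x y : Re (x + y) = Re x + Re y. Proof. by case: x; case: y. Qed.
Lemma ImD x y : Im (x + y) = Im x + Im y. Proof. by case: x; case: y. Qed.
Lemma ReM x y : Re (x * y) = Re x * Re y - Im x * Im y.
Proof. by case: x; case: y. Qed.
Lemma ImM x y : Im (x * y) = Re x * Im y + Im x * Re y.
Proof. by case: x => a b; case: y. Qed.
Lemma ReJ x : Re x^* = Re x. Proof. by case: x. Qed.
Lemma ImJ x : Im x^* = - Im x. Proof. by case: x. Qed.
Lemma conjC_rc (k : R) : (k%:C%C)^* = k%:C%C :> C.
Proof. exact: conjc_real. Qed.
Lemma complexP x y : Re x = Re y -> Im x = Im y -> x = y.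
Proof. by case: x y => [? ?] [? ?] /= -> ->. Qed.

Lemma Re_sum I (r : seq I) (P : pred I) (F : I -> C) :
  Re (\sum_(i <- r | P i) F i) = \sum_(i <- r | P i) Re (F i).
Proof. exact: (big_morph _ ReD). Qed.
Lemma Im_sum I (r : seq I) (P : pred I) (F : I -> C) :
  Im (\sum_(i <- r | P i) F i) = \sum_(i <- r | P i) Im (F i).
Proof. exact: (big_morph _ ImD). Qed.

Lemma hsE a b : hs a b = \sum_i \sum_j a i j * (b i j)^*.
Proof.
rewrite /hs /mxtrace; apply: eq_bigr => i _; rewrite mxE.
by apply: eq_bigr => j _; rewrite !mxE.
Qed.

Lemma hsDl a b c : hs (a + b) c = hs a c + hs b c.
Proof. by rewrite /hs mulmxDl mxtraceD. Qed.
Lemma hsZl x a b : hs (x *: a) b = x * hs a b.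
Proof. by rewrite /hs -scalemxAl mxtraceZ. Qed.
Lemma hsC a b : hs b a = (hs a b)^*.
Proof.
rewrite !hsE rmorph_sum; apply: eq_bigr => i _.
by rewrite rmorph_sum; apply: eq_bigr => j _; rewrite rmorphM /= conjCK mulrC.
Qed.
Lemma hsDr a b c : hs a (b + c) = hs a b + hs a c.
Proof. by rewrite hsC hsDl rmorphD /= -!hsC. Qed.
Lemma hsZr x a b : hs a (x *: b) = x^* * hs a b.
Proof. by rewrite hsC hsZl rmorphM /= -hsC. Qed.

Lemma hs_delta a i j : hs a (delta_mx i j) = a i j.
Proof.
rewrite hsE (bigD1 i) //= (bigD1 j) //= !big1 ?addr0 => [|k ki|k kj].
- by rewrite !mxE !eqxx rmorph1 mulr1.
- by apply: big1 => l _; rewrite !mxE (negbTE ki) rmorph0 mulr0.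
- by rewrite !mxE (negbTE kj) andbF rmorph0 mulr0.
Qed.

Lemma Re_hs_self q :
  Re (hs q q) = \sum_i \sum_j (Re (q i j) ^+ 2 + Im (q i j) ^+ 2).
Proof.
rewrite hsE Re_sum; apply: eq_bigr => i _; rewrite Re_sum.
by apply: eq_bigr => j _; rewrite ReM ReJ ImJ mulrN opprK.
Qed.

Lemma Im_hs_self q : Im (hs q q) = 0.
Proof. by have := congr1 Im (hsC q q); rewrite ImJ; lra. Qed.

Lemma hs_self_ge0 q : 0 <= Re (hs q q).
Proof.
by rewrite Re_hs_self; do 2!apply: sumr_ge0 => ? _; rewrite addr_ge0 ?sqr_ge0.
Qed.

Lemma hs_self_eq0 q : Re (hs q q) = 0 -> q = 0.
Proof.
rewrite Re_hs_self => /eqP; rewrite psumr_eq0 => [|i _]; last first.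
  by apply: sumr_ge0 => j _; rewrite addr_ge0 ?sqr_ge0.
move=> /allP h; apply/matrixP => i j; rewrite mxE.
have := h i (mem_index_enum i); rewrite psumr_eq0 => [|k _]; last first.
  by rewrite addr_ge0 ?sqr_ge0.
move=> /allP /(_ j (mem_index_enum j)) /=.
rewrite paddr_eq0 ?sqr_ge0 // !sqrf_eq0 => /andP[/eqP e1 /eqP e2].
exact: complexP.
Qed.

Lemma hs_self_gt0 q : q != 0 -> 0 < Re (hs q q).
Proof.
move=> q0; rewrite lt_neqAle hs_self_ge0 andbT eq_sym.
by apply: contraNneq q0 => /hs_self_eq0 ->.
Qed.

Lemma hs_normE q : hs_norm q = Num.sqrt (Re (hs q q)).
Proof. by rewrite /hs_norm /hs mxtrace_mulC. Qed.

Lemma hs_adj a b : hs (a ^t*)%sesqui (b ^t*)%sesqui = (hs a b)^*.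
Proof. by rewrite -hsC /hs trmxCK mxtrace_mulC. Qed.

Lemma unitary_adjK (u : M) : u \is unitarymx -> (u ^t* *m u = 1%:M)%sesqui.
Proof. by move=> /unitarymxP /mulmx1C. Qed.

Lemma adj_mul m p k (a : 'M[C]_(m, p)) (b : 'M[C]_(p, k)) :
  ((a *m b) ^t* = b ^t* *m a ^t*)%sesqui.
Proof. by rewrite trmx_mul map_mxM. Qed.

Lemma hs_conj (u a b : M) : u \is unitarymx ->
  (hs (u *m a *m u ^t*) (u *m b *m u ^t*))%sesqui = hs a b.
Proof.
move=> uU; rewrite /hs !adj_mul trmxCK !mulmxA -[_ *m u]mulmxA unitary_adjK //.
by rewrite mulmx1 mxtrace_mulC !mulmxA unitary_adjK // mul1mx.
Qed.

(** Bra-ket notation: |a><b|. *)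
Definition ketbra a b : 'End(M) := linfun (fun T : M => hs T b *: a).

Fact ketbra_linear a b : linear (fun T : M => hs T b *: a).
Proof. by move=> k S T; rewrite hsDl hsZl scalerDl scalerA. Qed.

Lemma ketbraE a b T : ketbra a b T = hs T b *: a.
Proof.
pose f : {linear M -> M} := HB.pack (fun T : M => hs T b *: a)
  (GRing.isLinear.Build _ _ _ _ _ (ketbra_linear a b)).
exact: (lfunE f).
Qed.

Lemma ketbraDl a b c : ketbra (a + b) c = ketbra a c + ketbra b c.
Proof.
by apply/lfunP => T; rewrite [LHS]ketbraE scalerDr add_lfunE !ketbraE.
Qed.
Lemma ketbraDr a b c : ketbra a (b + c) = ketbra a b + ketbra a c.
Proof.
by apply/lfunP => T; rewrite [LHS]ketbraE hsDr scalerDl add_lfunE !ketbraE.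
Qed.
Lemma ketbraZl x a b : ketbra (x *: a) b = x *: ketbra a b.
Proof.
by apply/lfunP => T; rewrite [LHS]ketbraE scale_lfunE ketbraE !scalerA mulrC.
Qed.
Lemma ketbraZr x a b : ketbra a (x *: b) = x^* *: ketbra a b.
Proof.
by apply/lfunP => T; rewrite [LHS]ketbraE scale_lfunE ketbraE hsZr scalerA.
Qed.

Lemma ketbra_adj a b S T : hs (ketbra a b S) T = hs S (ketbra b a T).
Proof. by rewrite !ketbraE hsZl hsZr mulrC -hsC. Qed.

Lemma hs_opE (p p' : 'End(M)) : hs_op p p' =
  \sum_i \sum_j \sum_k \sum_l
    p (delta_mx i j) k l * (p' (delta_mx i j) k l)^*.
Proof. by apply: eq_bigr => i _; apply: eq_bigr => j _; rewrite hsE. Qed.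

Lemma hs_opDl (p1 p2 p3 : 'End(M)) :
  hs_op (p1 + p2) p3 = hs_op p1 p3 + hs_op p2 p3.
Proof.
rewrite /hs_op -big_split; apply: eq_bigr => i _; rewrite -big_split.
by apply: eq_bigr => j _; rewrite add_lfunE hsDl.
Qed.
Lemma hs_opZl x (p1 p2 : 'End(M)) : hs_op (x *: p1) p2 = x * hs_op p1 p2.
Proof.
rewrite /hs_op mulr_sumr; apply: eq_bigr => i _; rewrite mulr_sumr.
by apply: eq_bigr => j _; rewrite scale_lfunE hsZl.
Qed.
Lemma hs_opDr (p1 p2 p3 : 'End(M)) :
  hs_op p1 (p2 + p3) = hs_op p1 p2 + hs_op p1 p3.
Proof.
rewrite /hs_op -big_split; apply: eq_bigr => i _; rewrite -big_split.
by apply: eq_bigr => j _; rewrite add_lfunE hsDr.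
Qed.
Lemma hs_opZr x (p1 p2 : 'End(M)) : hs_op p1 (x *: p2) = x^* * hs_op p1 p2.
Proof.
rewrite /hs_op mulr_sumr; apply: eq_bigr => i _; rewrite mulr_sumr.
by apply: eq_bigr => j _; rewrite scale_lfunE hsZr.
Qed.

Lemma hs_op_ketbra a b c d : hs_op (ketbra a b) (ketbra c d) = hs a c * hs d b.
Proof.
rewrite [hs d b]hsE mulr_sumr; apply: eq_bigr => i _.
rewrite mulr_sumr; apply: eq_bigr => j _.
rewrite !ketbraE hsZl hsZr ![hs (delta_mx _ _) _]hsC !hs_delta conjCK.
by rewrite mulrC [_ * hs a c]mulrC -mulrA.
Qed.

End HilbertSchmidt.

(** * Euclidean coordinates on the target *)

Section HermitianMatrices.
Variables (R : realType) (m : nat).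
Local Notation C := R[i].
Local Notation Re := (@complex.Re R).
Local Notation Im := (@complex.Im R).

(** The symmetric and the antisymmetric half of a real matrix serve as real
    and imaginary part, so that the m^2 real parameters of a Hermitian matrix
    come without a choice of basis. *)
Definition herm (B : 'M[R]_m) : 'M[C]_m :=
  \matrix_(i, j) ((B i j + B j i) / 2 +i* ((B i j - B j i) / 2))%C.

Definition unherm (H : 'M[C]_m) : 'M[R]_m :=
  \matrix_(i, j) (Re (H i j) + Im (H i j)).

Lemma herm_adj B : ((herm B) ^t* = herm B)%sesqui.
Proof.
by apply/matrixP => i j; rewrite !mxE; apply: complexP; rewrite /=; field.
Qed.

Lemma hermK B : unherm (herm B) = B.
Proof. by apply/matrixP => i j; rewrite !mxE /=; field. Qed.

Lemma unhermK (H : 'M[C]_m) : (H ^t* = H)%sesqui -> herm (unherm H) = H.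
Proof.
move=> hH; apply/matrixP => i j; rewrite !mxE.
have /(congr1 (fun x => (Re x, Im x))) [] : H j i = (H i j)^*.
  by rewrite -[in LHS]hH !mxE.
by rewrite ReJ ImJ => -> ->; apply: complexP => /=; field.
Qed.

Lemma hermD B B' : herm (B + B') = herm B + herm B'.
Proof. by apply/matrixP => i j; rewrite !mxE; apply: complexP => /=; field. Qed.

Lemma hermZ (k : R) B : herm (k *: B) = k%:C%C *: herm B.
Proof. by apply/matrixP => i j; rewrite !mxE; apply: complexP => /=; field. Qed.

Lemma unhermD H H' : unherm (H + H') = unherm H + unherm H'.
Proof. by apply/matrixP => i j; rewrite !mxE ReD ImD addrACA. Qed.

Lemma unhermZ (k : R) H : unherm (k%:C%C *: H) = k *: unherm H.
Proof. by apply/matrixP => i j; rewrite !mxE ReM ImM /=; ring. Qed.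

(** The products of a real by an imaginary part are antisymmetric in the two
    indices, so they cancel in the sum over all entries. *)
Lemma unherm_dot H H' : (H ^t* = H)%sesqui -> (H' ^t* = H')%sesqui ->
  \sum_i \sum_j unherm H i j * unherm H' i j = Re (hs H H').
Proof.
move=> hH hH'; rewrite hsE Re_sum.
have -> : \sum_i \sum_j unherm H i j * unherm H' i j =
   \sum_i Re (\sum_j H i j * (H' i j)^*) +
   \sum_i \sum_j (Re (H i j) * Im (H' i j) + Im (H i j) * Re (H' i j)).
  rewrite -big_split; apply: eq_bigr => i _; rewrite Re_sum -big_split.
  by apply: eq_bigr => j _; rewrite !mxE ReM ReJ ImJ /=; ring.
set s := (X in _ + X); suff : s = - s by lra.
rewrite /s [LHS]exchange_big -sumrN; apply: eq_bigr => i _.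
rewrite -sumrN; apply: eq_bigr => j _.
rewrite -[in LHS]hH -[in LHS]hH' !mxE !ReJ !ImJ; ring.
Qed.

End HermitianMatrices.

Section Identification.
Variables (R : realType) (n : nat).
Local Notation C := R[i].
Local Notation M := 'M[C]_n.
Local Notation Re := (@complex.Re R).
Local Notation Im := (@complex.Im R).
Local Notation N := ((n ^ 2 + 1) ^ 2)%N.
Implicit Types (p : 'End(M)) (H : 'M[C]_(n * n)) (t : target R n).

Definition mxop H : 'End(M) := linfun (vec_mx \o mulmxr H \o mxvec).

Lemma mxopE H T : mxop H T = vec_mx (mxvec T *m H).
Proof. exact: lfunE. Qed.

Lemma lin_mx_mxop H : lin_mx (mxop H) = H.
Proof.
apply/row_matrixP => k; rewrite [LHS]rowE [RHS]rowE.
by rewrite mul_rV_lin /= mxopE !vec_mxK.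
Qed.

Lemma mxop_lin_mx p : mxop (lin_mx p) = p.
Proof. by apply/lfunP => T; rewrite mxopE mx_vec_lin. Qed.

Lemma mxopD H H' : mxop (H + H') = mxop H + mxop H'.
Proof.
by apply/lfunP => T; rewrite [LHS]mxopE mulmxDr linearD add_lfunE !mxopE.
Qed.

Lemma mxopZ (k : C) H : mxop (k *: H) = k *: mxop H.
Proof.
by apply/lfunP => T; rewrite [LHS]mxopE -scalemxAr linearZ scale_lfunE mxopE.
Qed.

Lemma lin_mx_lfunD p p' : lin_mx (p + p') = lin_mx p + lin_mx p'.
Proof.
by rewrite -{1}(mxop_lin_mx p) -{1}(mxop_lin_mx p') -mxopD lin_mx_mxop.
Qed.

Lemma lin_mx_lfunZ (k : C) p : lin_mx (k *: p) = k *: lin_mx p.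
Proof. by rewrite -{1}(mxop_lin_mx p) -mxopZ lin_mx_mxop. Qed.

Lemma lin_mx_lfunE p i j k l :
  lin_mx p (mxvec_index i j) (mxvec_index k l) = p (delta_mx i j) k l.
Proof.
by rewrite -[RHS]mxvecE -[mxvec (p _)]mul_vec_lin mxvec_delta -rowE [RHS]mxE.
Qed.

Lemma sum_mxvec (V : nmodType) a b (F : 'I_(a * b) -> V) :
  \sum_k F k = \sum_i \sum_j F (mxvec_index i j).
Proof.
by rewrite pair_bigA (reindex _ (curry_mxvec_bij _ _)); apply: eq_bigr => -[].
Qed.

(** The matrix units form an orthonormal basis, so self-adjointness is read off
    the matrix of the operator. *)
Lemma selfadjointP p : selfadjoint p <-> ((lin_mx p) ^t* = lin_mx p)%sesqui.
Proof.
split=> [sp|hp A B].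
  apply/matrixP => x y.
  case/mxvec_indexP: x => i j; case/mxvec_indexP: y => k l.
  rewrite [LHS]mxE [in LHS]mxE !lin_mx_lfunE -[RHS]hs_delta sp.
  by rewrite hsC hs_delta.
have hsv (S T : M) : hs S T = (mxvec S *m (mxvec T) ^t*)%sesqui 0 0.
  rewrite mxE sum_mxvec hsE; apply: eq_bigr => i _; apply: eq_bigr => j _.
  by rewrite !mxE !mxvecE.
rewrite !hsv -[mxvec (p A)]mul_vec_lin -[mxvec (p B)]mul_vec_lin.
by rewrite adj_mul hp !mulmxA.
Qed.

Lemma hs_op_lin_mx p p' : hs_op p p' = hs (lin_mx p) (lin_mx p').
Proof.
rewrite hs_opE hsE sum_mxvec; apply: eq_bigr => i _; apply: eq_bigr => j _.
rewrite sum_mxvec; apply: eq_bigr => k _; apply: eq_bigr => l _.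
by rewrite !lin_mx_lfunE.
Qed.

(** A vector is read as a real square matrix of size n^2 + 1: the last entry
    holds the scalar, the rest of the last column and of the last row hold the
    real and imaginary parts of the matrix component, and the remaining block
    encodes the Hermitian operator.  The square roots absorb the weights 5/2
    and 1/2 of the inner product. *)
Definition of_vec (y : 'rV[R]_N) : target R n :=
  let W : 'M[R]_(n * n + 1, n * n + 1) := vec_mx y in
  ((Num.sqrt (5 / 2))^-1 * drsubmx W ord0 ord0,
   of_real (vec_mx (ursubmx W)^T, vec_mx (dlsubmx W)),
   mxop (herm (Num.sqrt 2 *: ulsubmx W))).

Definition to_vec t : 'rV[R]_N :=
  mxvec (block_mx ((Num.sqrt 2)^-1 *: unherm (lin_mx t.2))
                  (mxvec (to_real t.1.2).1)^T
                  (mxvec (to_real t.1.2).2)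
                  (const_mx (Num.sqrt (5 / 2) * t.1.1))
         : 'M[R]_(n * n + 1, n * n + 1)).

Lemma of_realK : cancel (@of_real R n) (@to_real R n).
Proof.
by move=> [x y]; congr (_, _); apply/matrixP => i j; rewrite !mxE.
Qed.

Lemma to_realK : cancel (@to_real R n) (@of_real R n).
Proof. by move=> q; apply/matrixP => i j; rewrite !mxE; case: (q i j). Qed.

Lemma sqrt2_neq0 : Num.sqrt 2 != 0 :> R.
Proof. by rewrite sqrtr_eq0 -ltNge ltr0n. Qed.

Lemma sqrt52_neq0 : Num.sqrt (5 / 2) != 0 :> R.
Proof. by rewrite sqrtr_eq0 -ltNge divr_gt0 ?ltr0n. Qed.

Lemma of_vecK : cancel of_vec to_vec.
Proof.
move=> y; rewrite /to_vec; set W : 'M[R]_(n * n + 1, n * n + 1) := vec_mx y.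
have -> : to_real (of_vec y).1.2 = (vec_mx (ursubmx W)^T, vec_mx (dlsubmx W)).
  exact: of_realK.
rewrite /of_vec -/W /= !vec_mxK trmxK lin_mx_mxop hermK scalerK ?sqrt2_neq0 //.
have -> : const_mx (Num.sqrt (5 / 2) * ((Num.sqrt (5 / 2))^-1 *
    drsubmx W ord0 ord0)) = drsubmx W.
  by apply/matrixP => i j; rewrite mxE mulVKf ?sqrt52_neq0 // !ord1.
by rewrite submxK vec_mxK.
Qed.

Lemma to_vecK t : selfadjoint t.2 -> of_vec (to_vec t) = t.
Proof.
case: t => [[x q] p] /= /selfadjointP hp.
rewrite /of_vec mxvecK block_mxKul block_mxKur block_mxKdl block_mxKdr /=.
rewrite trmxK !mxvecK -[of_real _]/(of_real (to_real q)) to_realK.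
rewrite scalerA mulfV ?sqrt2_neq0 // scale1r unhermK // mxop_lin_mx.
by rewrite mxE mulKf ?sqrt52_neq0.
Qed.

Lemma of_vec_selfadjoint y : selfadjoint (of_vec y).2.
Proof. by apply/selfadjointP; rewrite /= lin_mx_mxop herm_adj. Qed.

Lemma euclid_dot_block (A B : 'M[R]_(n * n)) (a b : 'cV[R]_(n * n))
    (c d : 'rV[R]_(n * n)) (x y : 'M[R]_1) :
  euclid_dot (mxvec (block_mx A a c x) : 'rV_N) (mxvec (block_mx B b d y))
  = \sum_i \sum_j A i j * B i j + \sum_i a i 0 * b i 0
    + \sum_i c 0 i * d 0 i + x 0 0 * y 0 0.
Proof.
have -> : euclid_dot (mxvec (block_mx A a c x) : 'rV_N)
                     (mxvec (block_mx B b d y)) =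
    \sum_i \sum_j block_mx A a c x i j * block_mx B b d y i j.
  rewrite /euclid_dot [LHS]sum_mxvec; apply: eq_bigr => i _.
  by apply: eq_bigr => j _; rewrite !mxvecE.
rewrite big_split_ord /= -addrA; congr (_ + _).
  rewrite -big_split; apply: eq_bigr => i _; rewrite big_split_ord big_ord1 /=.
  rewrite !block_mxEur; congr (_ + _); apply: eq_bigr => j _.
  by rewrite !block_mxEul.
rewrite big_ord1 big_split_ord big_ord1 /= !block_mxEdr; congr (_ + _).
by apply: eq_bigr => j _; rewrite !block_mxEdl.
Qed.

Lemma to_vec_dot t t' : selfadjoint t.2 -> selfadjoint t'.2 ->
  euclid_dot (to_vec t) (to_vec t') = target_dot t t'.
Proof.
move=> /selfadjointP h /selfadjointP h'; rewrite euclid_dot_block /target_dot.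
rewrite hs_op_lin_mx -(unherm_dot h h').
have scaled (U U' : 'M[R]_(n * n)) :
    \sum_i \sum_j ((Num.sqrt 2)^-1 *: U) i j * ((Num.sqrt 2)^-1 *: U') i j =
    2^-1 * \sum_i \sum_j U i j * U' i j.
  rewrite mulr_sumr; apply: eq_bigr => i _; rewrite mulr_sumr.
  apply: eq_bigr => j _; rewrite !mxE mulrACA -invfM -expr2.
  by rewrite sqr_sqrtr ?ler0n.
rewrite scaled.
rewrite [const_mx _ _ _]mxE [const_mx _ _ _]mxE mulrACA -expr2.
rewrite sqr_sqrtr; last by rewrite divr_ge0 ?ler0n.
rewrite -[X in X + _ = _]addrA -[LHS]addrA [LHS]addrC [X in X + _ = _]addrC.
congr (_ + _ + _).
rewrite hsE Re_sum !sum_mxvec -big_split; apply: eq_bigr => i _.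
rewrite Re_sum -big_split; apply: eq_bigr => j _.
by rewrite [_^T _ _]mxE [_^T _ _]mxE !mxvecE !mxE ReM ReJ ImJ mulrN opprK.
Qed.

Lemma of_vecD x y : of_vec (x + y) =
  ((of_vec x).1.1 + (of_vec y).1.1, (of_vec x).1.2 + (of_vec y).1.2,
   (of_vec x).2 + (of_vec y).2).
Proof.
rewrite /of_vec; set W := vec_mx (x + y).
have -> : W = vec_mx x + vec_mx y by exact: linearD.
congr (_, _, _).
- by rewrite !mxE mulrDr.
- apply/matrixP => i j; rewrite !mxE; apply: complexP; rewrite ?ReD ?ImD //=;
  by rewrite !mxE.
- rewrite -mxopD -hermD -scalerDr; congr (mxop (herm (_ *: _))).
  by apply/matrixP => i j; rewrite !mxE.
Qed.

Lemma of_vecZ (k : R) x : of_vec (k *: x) =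
  (k * (of_vec x).1.1, k%:C%C *: (of_vec x).1.2, k%:C%C *: (of_vec x).2).
Proof.
rewrite /of_vec; set W := vec_mx (k *: x).
have -> : W = k *: vec_mx x by exact: linearZ.
congr (_, _, _).
- by rewrite !mxE mulrCA.
- apply/matrixP => i j; rewrite !mxE; apply: complexP; rewrite ?ReM ?ImM /=;
  by rewrite ?mxE; ring.
- rewrite -mxopZ -hermZ scalerA mulrC -scalerA; congr (mxop (herm (_ *: _))).
  by apply/matrixP => i j; rewrite !mxE.
Qed.

Lemma of_vec_identification : isometric_identification of_vec.
Proof.
split; [exact: of_vecD | exact: of_vecZ | | move=> x y].
  rewrite eqEsubset; split=> [_ [y _ <-]|t st]; first exact: of_vec_selfadjoint.
  by exists (to_vec t) => //; exact: to_vecK.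
by rewrite -to_vec_dot ?of_vecK //; exact: of_vec_selfadjoint.
Qed.

Lemma to_vecD (x x' : R) (q q' : M) p p' :
  to_vec (x, q, p) + to_vec (x', q', p') = to_vec (x + x', q + q', p + p').
Proof.
rewrite /to_vec /= -linearD; congr mxvec.
rewrite add_block_mx lin_mx_lfunD unhermD scalerDr; congr block_mx.
- rewrite -linearD -linearD /=; congr (mxvec _)^T.
  by apply/matrixP => i j; rewrite !mxE ReD.
- by rewrite -linearD; congr mxvec; apply/matrixP => i j; rewrite !mxE ImD.
- by apply/matrixP => i j; rewrite !mxE mulrDr.
Qed.

Lemma to_vecZ (k x : R) (q : M) p :
  k *: to_vec (x, q, p) = to_vec (k * x, k%:C%C *: q, k%:C%C *: p).
Proof.
rewrite /to_vec /= -linearZ; congr mxvec.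
rewrite scale_block_mx lin_mx_lfunZ unhermZ; congr block_mx.
- by rewrite !scalerA mulrC.
- rewrite -linearZ -linearZ /=; congr (mxvec _)^T; apply/matrixP => i j.
  by rewrite !mxE ReM /= mul0r subr0.
- rewrite -linearZ; congr mxvec; apply/matrixP => i j.
  by rewrite !mxE ImM /= mul0r addr0.
- by apply/matrixP => i j; rewrite !mxE mulrCA.
Qed.

End Identification.

(** * Linear and quadratic maps of pairs of real matrices *)

Section FiniteDimension.
Variables (R : realType) (m n : nat) (W : normedModType R).
Local Notation V := ('M[R]_(m, n) * 'M[R]_(m, n))%type.
Implicit Types (f : V -> W) (B : V -> V -> W).

Lemma linear_coord f (z : V) : linear f ->
  f z = \sum_i \sum_j (z.1 i j *: f (delta_mx i j, 0) +
                       z.2 i j *: f (0, delta_mx i j)).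
Proof.
move=> lf; pose F : {linear V -> W} := HB.pack f
  (GRing.isLinear.Build _ _ _ _ _ lf).
have -> : f = F by [].
have {1}-> : z = \sum_i \sum_j (z.1 i j *: (delta_mx i j, 0) +
                       z.2 i j *: (0, delta_mx i j)).
  apply: injective_projections => /=.
    rewrite [LHS]matrix_sum_delta raddf_sum; apply: eq_bigr => i _.
    rewrite raddf_sum; apply: eq_bigr => j _.
    by rewrite /= scaler0 addr0.
  rewrite [LHS]matrix_sum_delta raddf_sum; apply: eq_bigr => i _.
  rewrite raddf_sum; apply: eq_bigr => j _.
  by rewrite /= scaler0 add0r.
rewrite linear_sum; apply: eq_bigr => i _; rewrite linear_sum.
by apply: eq_bigr => j _; rewrite linearD !linearZ.
Qed.

Lemma coord1_continuous i j : continuous (fun z : V => z.1 i j).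
Proof.
move=> z; apply: (@continuous_comp _ _ _ fst (fun x : 'M[R]_(m, n) => x i j)).
  exact: cvg_fst.
exact: coord_continuous.
Qed.

Lemma coord2_continuous i j : continuous (fun z : V => z.2 i j).
Proof.
move=> z; apply: (@continuous_comp _ _ _ snd (fun x : 'M[R]_(m, n) => x i j)).
  exact: cvg_snd.
exact: coord_continuous.
Qed.

Lemma linear_pair_mx_continuous f : linear f -> continuous f.
Proof.
move=> lf; suff: Ck 0 setT f by move=> h z; exact: h.
apply: (Ck_ext openT (fun y _ => esym (linear_coord y lf))).
apply: (Ck_sum openT) => i; apply: (Ck_sum openT) => j.
apply: (CkD openT); apply: (CkZ openT) (Ck_cst openT _ _) => z _.
  exact: coord1_continuous.
exact: coord2_continuous.
Qed.

Variable B : V -> V -> W.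
Hypotheses (lB : forall y, linear (B^~ y)) (rB : forall x, linear (B x)).

Lemma bilinear_pair_mx_continuous : continuous (fun p : V * V => B p.1 p.2).
Proof.
suff: Ck 0 setT (fun p : V * V => B p.1 p.2) by move=> h z; exact: h.
apply: (Ck_ext openT (fun p _ => esym (linear_coord p.1 (lB p.2)))).
have c1 i j : continuous (fun p : V * V => p.1.1 i j).
  move=> p; apply: (@continuous_comp _ _ _ fst (fun z : V => z.1 i j)).
    exact: cvg_fst.
  exact: coord1_continuous.
have c2 i j : continuous (fun p : V * V => p.1.2 i j).
  move=> p; apply: (@continuous_comp _ _ _ fst (fun z : V => z.2 i j)).
    exact: cvg_fst.
  exact: coord2_continuous.
have c3 v : continuous (fun p : V * V => B v p.2).
  move=> p; apply: (@continuous_comp _ _ _ snd (B v)); first exact: cvg_snd.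
  exact: linear_pair_mx_continuous.
apply: (Ck_sum openT) => i; apply: (Ck_sum openT) => j.
by apply: (CkD openT); apply: (CkZ openT) => z _;
  [exact: c1 | exact: c3 | exact: c2 | exact: c3].
Qed.

Lemma is_diff_quadratic x :
  is_diff x (fun z => B z z) (fun h => B x h + B h x).
Proof.
have bB : bilinear_for (GRing.Scale.Law.clone _ _ *:%R _)
    (GRing.Scale.Law.clone _ _ *:%R _) B.
  by split=> [y|y]; [exact: lB | exact: rB].
pose F : {bilinear V -> V -> W} := HB.pack B
  (bilinear_isBilinear.Build R V V W _ _ B bB).
have cF : continuous (fun p : V * V => F p.1 p.2).
  exact: bilinear_pair_mx_continuous.
have dF : is_diff (x, x) (fun p : V * V => F p.1 p.2)
    (fun q => F x q.2 + F q.1 x).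
  apply: DiffDef; first exact: differentiable_bilin.
  exact: diff_bilin.
exact: (is_diff_comp (is_diff_pair (is_diff_id x) (is_diff_id x)) dF).
Qed.

(** The derivative of a quadratic map is linear in the base point, so a single
    differentiation reaches the regularity of linear maps. *)
Lemma Ck_quadratic (U : set V) k : open U -> Ck k U (fun z => B z z).
Proof.
move=> oU; case: k => [|k].
  move=> x _; apply: differentiable_continuous.
  by have := is_diff_quadratic x => ?; exact: ex_diff.
apply: (CkS oU (df := fun x h => B x h + B h x)) => [x _|v].
  exact: is_diff_quadratic.
have ld : linear (fun x => B x v + B v x).
  by move=> a x y; rewrite lB rB scalerDr addrACA.
pose F : {linear V -> W} := HB.pack (fun x => B x v + B v x)
  (GRing.isLinear.Build _ _ _ _ _ ld).
apply: (@Ck_linear _ _ _ oU _ k F); exact: linear_pair_mx_continuous.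
Qed.

End FiniteDimension.

(** * The embedding and its differential *)

Section EmbeddingMap.
Variables (R : realType) (n : nat).
Local Notation C := R[i].
Local Notation M := 'M[C]_n.
Local Notation Re := (@complex.Re R).
Local Notation Im := (@complex.Im R).
Local Notation V := ('M[R]_n * 'M[R]_n)%type.
Local Notation N := ((n ^ 2 + 1) ^ 2)%N.
Implicit Types (q a b : M) (z h : V).

Lemma of_real_linear (k : R) z h :
  of_real (k *: z + h) = k%:C%C *: of_real z + of_real h.
Proof.
apply/matrixP => i j; rewrite !mxE; apply: complexP => /=; first by ring.
by ring.
Qed.

Definition rdot a b : R := Re (hs a b).
Definition nsq q : R := rdot q q.

Lemma rdotC a b : rdot a b = rdot b a.
Proof. by rewrite /rdot hsC ReJ. Qed.

Lemma rdotDl a b q : rdot (a + b) q = rdot a q + rdot b q.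
Proof. by rewrite /rdot hsDl ReD. Qed.
Lemma rdotZl (k : R) a q : rdot (k%:C%C *: a) q = k * rdot a q.
Proof. by rewrite /rdot hsZl ReM /= mul0r subr0. Qed.

Lemma rdot_linearl h :
  linear ((fun z h => rdot (of_real z) (of_real h))^~ h : V -> R).
Proof. by move=> k x y; rewrite of_real_linear rdotDl rdotZl. Qed.
Lemma rdot_linearr z : linear (fun h => rdot (of_real z) (of_real h) : R).
Proof.
by move=> k x y; rewrite rdotC rdot_linearl ![rdot _ (of_real z)]rdotC.
Qed.

(** This is r^(-1/2) for r = ||q||; it is the only function in the embedding
    that is not polynomial in the entries of q. *)
Definition weight q : R := nsq q `^ (- (1 / 4)).

Lemma weight_gt0 q : q != 0 -> 0 < weight q.
Proof. by move=> q0; rewrite powR_gt0 // hs_self_gt0. Qed.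

Lemma weightX4 q : q != 0 -> nsq q = (weight q ^+ 4)^-1.
Proof.
move=> q0; have m0 : 0 < nsq q by exact: hs_self_gt0.
rewrite -powR_mulrn ?powR_ge0 // -powRrM mulNr -mulrA.
rewrite (_ : 1 * (4^-1 * 4%:R) = 1); last by field.
by rewrite powR_inv1 ?ltW // invrK.
Qed.

Lemma weightX5 q : q != 0 -> weight q ^+ 5 = nsq q `^ (- (1 / 4) - 1).
Proof.
move=> q0; have m0 : 0 < nsq q by exact: hs_self_gt0.
rewrite -powR_mulrn ?powR_ge0 // -powRrM; congr (_ `^ _); by field.
Qed.

(** With r = ||q||, the components are r^(1/2), r^(-1/2) q and
    r^(-3/2) |q><q|. *)
Definition calabi_map q : target R n :=
  (nsq q * weight q ^+ 3, (weight q)%:C%C *: q,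
   (weight q ^+ 3)%:C%C *: ketbra q q).

(** Obtained by differentiating [weight ^+ 4 * nsq = 1]. *)
Definition dweight q a : R := - (1 / 2) * weight q ^+ 5 * rdot q a.

(** The differential of [calabi_map]; its scalar component is simplified with
    [weight ^+ 4 * nsq = 1]. *)
Definition dcalabi_map q a : target R n :=
  (weight q ^+ 3 * rdot q a / 2,
   (weight q)%:C%C *: a + (dweight q a)%:C%C *: q,
   (weight q ^+ 3)%:C%C *: (ketbra q a + ketbra a q) +
     (3 * weight q ^+ 2 * dweight q a)%:C%C *: ketbra q q).

Definition nz : set V := [set z | of_real z != 0].

Lemma is_diff_nsq z :
  is_diff z (nsq \o @of_real R n)
    (fun h => 2 * rdot (of_real z) (of_real h) : R).
Proof.
have := is_diff_quadratic rdot_linearl rdot_linearr z.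
move=> hd; apply: (is_diff_eq hd); apply/funext => h.
by rewrite [rdot (of_real h) _]rdotC mulr_natl.
Qed.

Lemma nz_open : open nz.
Proof.
have -> : nz = (nsq \o @of_real R n) @^-1` [set x | x != 0].
  apply/seteqP; split=> z /=.
    by move/hs_self_gt0; rewrite lt0r => /andP[].
  by apply: contraNneq => ->; rewrite /nsq /rdot hsE Re_sum big1 // => i _;
     rewrite big1 // => j _; rewrite mxE mul0r.
apply: open_comp; last exact: open_neq.
move=> z _; apply: differentiable_continuous.
by have := is_diff_nsq z => ?; exact: ex_diff.
Qed.

Lemma is_diff_weight z : nz z -> is_diff z (weight \o @of_real R n)
  (fun h => dweight (of_real z) (of_real h) : R).
Proof.
move=> z0; have m0 : 0 < nsq (of_real z) by exact: hs_self_gt0.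
have [dp ep] := is_derive1_powR (- (1 / 4)) m0.
have dP : is_diff (nsq (of_real z)) (fun x : R => x `^ (- (1 / 4)))
    (fun h : R => h * (- (1 / 4) * nsq (of_real z) `^ (- (1 / 4) - 1))).
  apply: DiffDef; first exact/derivable1_diffP.
  by rewrite deriv1E // derive1E ep.
have hd := is_diff_comp (is_diff_nsq z) dP.
apply: (is_diff_eq hd); apply/funext => h /=.
by rewrite /dweight weightX5 //; field.
Qed.

(** Each derivative of the weight is a power of the weight times a linear
    function, so regularity is gained by induction. *)
Lemma Ck_weight k : Ck k nz (weight \o @of_real R n).
Proof.
elim: k => [|k IHk].
  move=> z nzz; apply: differentiable_continuous.
  by have := is_diff_weight nzz => ?; exact: ex_diff.
apply: (CkS nz_open is_diff_weight) => h.
apply: (@CkZ _ _ _ nz_open R k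
  (fun z => - (1 / 2) * weight (of_real z) ^+ 5)
  (fun z => rdot (of_real z) (of_real h))).
  apply: (@CkZ _ _ _ nz_open R k (fun=> - (1 / 2))).
    exact: (Ck_cst nz_open).
  exact: (CkX nz_open 5 IHk).
pose F : {linear V -> R} := HB.pack (fun z => rdot (of_real z) (of_real h))
  (GRing.isLinear.Build _ _ _ _ _ (rdot_linearl h)).
apply: (@Ck_linear _ _ _ nz_open R k F).
exact: (linear_pair_mx_continuous (rdot_linearl h)).
Qed.

Lemma selfadjointD p p' : @selfadjoint R n p -> selfadjoint p' ->
  selfadjoint (p + p').
Proof. by move=> hp hp' A B; rewrite !add_lfunE hsDl hsDr hp hp'. Qed.

Lemma selfadjointZ (k : R) p : @selfadjoint R n p -> selfadjoint (k%:C%C *: p).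
Proof. by move=> hp A B; rewrite !scale_lfunE hsZl hsZr hp conjC_rc. Qed.

Lemma selfadjoint_ketbra q a : selfadjoint (ketbra q a + ketbra a q).
Proof.
move=> A B; rewrite !add_lfunE hsDl hsDr !(ketbra_adj _ _ A).
exact: addrC.
Qed.

Lemma selfadjoint_ketbra_self q : selfadjoint (ketbra q q).
Proof. by move=> A B; exact: ketbra_adj. Qed.

Lemma calabi_map_selfadjoint q : selfadjoint (calabi_map q).2.
Proof. exact/selfadjointZ/selfadjoint_ketbra_self. Qed.

Lemma dcalabi_map_selfadjoint q a : selfadjoint (dcalabi_map q a).2.
Proof.
apply: selfadjointD; apply: selfadjointZ; first exact: selfadjoint_ketbra.
exact: selfadjoint_ketbra_self.
Qed.

Definition vec1 : 'rV[R]_N := to_vec (1, 0, 0).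
Definition vec_mat z : 'rV[R]_N := to_vec (0, of_real z, 0).
Definition vec_ketbra z h : 'rV[R]_N :=
  to_vec (0, 0, ketbra (of_real z) (of_real h)).

Lemma vec_mat_linear : linear vec_mat.
Proof.
move=> k z h; rewrite /vec_mat of_real_linear to_vecZ to_vecD.
by rewrite mulr0 addr0 scaler0 addr0.
Qed.

Lemma vec_ketbra_linearl h : linear (vec_ketbra^~ h).
Proof.
move=> k x y; rewrite /vec_ketbra of_real_linear ketbraDl ketbraZl.
by rewrite to_vecZ to_vecD mulr0 addr0 scaler0 addr0.
Qed.

Lemma vec_ketbra_linearr z : linear (vec_ketbra z).
Proof.
move=> k x y; rewrite /vec_ketbra of_real_linear ketbraDr ketbraZr conjC_rc.
by rewrite to_vecZ to_vecD mulr0 addr0 scaler0 addr0.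
Qed.

Lemma to_vec_split (x : R) q (p : 'End(M)) :
  to_vec (x, q, p) = to_vec (x, 0, 0) + to_vec (0, q, 0) + to_vec (0, 0, p).
Proof. by rewrite !to_vecD !addr0 !add0r. Qed.

Lemma vec1Z (k : R) : k *: vec1 = to_vec (k, 0, 0).
Proof. by rewrite to_vecZ mulr1 !scaler0. Qed.

Lemma vec_matZ (k : R) z : k *: vec_mat z = to_vec (0, k%:C%C *: of_real z, 0).
Proof. by rewrite to_vecZ mulr0 scaler0. Qed.

Lemma vec_ketbraZ (k : R) z h : k *: vec_ketbra z h =
  to_vec (0, 0, k%:C%C *: ketbra (of_real z) (of_real h)).
Proof. by rewrite to_vecZ mulr0 scaler0. Qed.

(** A constant, a linear and a quadratic map of q with scalar coefficients: the
    regularity of the embedding reduces to that of the coefficients. *)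
Lemma to_vec_calabi_map z : to_vec (calabi_map (of_real z)) =
  (nsq (of_real z) * weight (of_real z) ^+ 3) *: vec1
  + weight (of_real z) *: vec_mat z + weight (of_real z) ^+ 3 *: vec_ketbra z z.
Proof.
rewrite /calabi_map to_vec_split; congr (_ + _ + _).
- exact/esym/vec1Z.
- exact/esym/vec_matZ.
- exact/esym/vec_ketbraZ.
Qed.

Lemma to_vec_dcalabi_map z h : to_vec (dcalabi_map (of_real z) (of_real h)) =
  (weight (of_real z) ^+ 3 * rdot (of_real z) (of_real h) / 2) *: vec1
  + (weight (of_real z) *: vec_mat h
     + dweight (of_real z) (of_real h) *: vec_mat z)
  + (weight (of_real z) ^+ 3 *: (vec_ketbra z h + vec_ketbra h z)
     + (3 * weight (of_real z) ^+ 2 * dweight (of_real z) (of_real h))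
         *: vec_ketbra z z).
Proof.
rewrite /dcalabi_map to_vec_split; congr (_ + _ + _).
- exact/esym/vec1Z.
- by rewrite (vec_matZ _ h) (vec_matZ _ z) to_vecD !addr0.
- have -> : vec_ketbra z h + vec_ketbra h z = to_vec (0, 0,
      ketbra (of_real z) (of_real h) + ketbra (of_real h) (of_real z)).
    by apply: (etrans (to_vecD _ _ _ _ _ _)); rewrite !addr0.
  by rewrite vec_ketbraZ to_vecZ to_vecD mulr0 scaler0 !addr0.
Qed.

Definition embed (z : M * bool) : 'rV[R]_N :=
  (-1) ^+ z.2 *: to_vec (calabi_map z.1).

Lemma sheet_embed s : sheet embed s = (fun z => (-1) ^+ s *: (
  (nsq (of_real z) * weight (of_real z) ^+ 3) *: vec1
  + weight (of_real z) *: vec_mat z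
  + weight (of_real z) ^+ 3 *: vec_ketbra z z)).
Proof. by apply/funext => z; rewrite -to_vec_calabi_map. Qed.

Lemma Ck_sheet_embed s k : Ck k nz (sheet embed s).
Proof.
rewrite sheet_embed; have hw := Ck_weight k.
apply: (CkZ nz_open); first exact: (Ck_cst nz_open).
have hq := Ck_quadratic vec_ketbra_linearl vec_ketbra_linearr k nz_open.
have hm := Ck_quadratic rdot_linearl rdot_linearr k nz_open.
pose F : {linear V -> 'rV[R]_N} := HB.pack vec_mat
  (GRing.isLinear.Build _ _ _ _ _ vec_mat_linear).
have hl : Ck k nz vec_mat.
  apply: (@Ck_linear _ _ _ nz_open _ k F).
  exact: (linear_pair_mx_continuous vec_mat_linear).
apply: (CkD nz_open); last exact: (CkZ nz_open (CkX nz_open 3 hw) hq).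
apply: (CkD nz_open); last exact: (CkZ nz_open hw hl).
apply: (@CkZ _ _ _ nz_open _ _ _ _ _ (Ck_cst nz_open k vec1)).
exact: (@CkZ _ _ _ nz_open R _ _ _ hm (CkX nz_open 3 hw)).
Qed.

Lemma is_diff_sheet_embed s z : nz z -> is_diff z (sheet embed s)
  (fun h => (-1) ^+ s *: to_vec (dcalabi_map (of_real z) (of_real h))).
Proof.
move=> z0; rewrite sheet_embed.
have dw := is_diff_weight z0.
have dw3 : is_diff z (fun z => weight (of_real z) ^+ 3)
    (fun h => 3 * weight (of_real z) ^+ 2
              * dweight (of_real z) (of_real h) : R).
  have := is_diff_scale dw (is_diff_scale dw dw).
  move=> hd; apply: (is_diff_eq hd); apply/funext => h /=.
  by rewrite /GRing.scale /=; ring.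
have dx : is_diff z (fun z => nsq (of_real z) * weight (of_real z) ^+ 3)
    (fun h => weight (of_real z) ^+ 3 * rdot (of_real z) (of_real h) / 2 : R).
  have := is_diff_scale (is_diff_nsq z) dw3.
  move=> hd; apply: (is_diff_eq hd); apply/funext => h /=.
  have := weight_gt0 z0; rewrite /GRing.scale /= /dweight weightX4 // => w0.
  by field; rewrite gt_eqF.
have dl : is_diff z vec_mat vec_mat.
  pose F : {linear V -> 'rV[R]_N} := HB.pack vec_mat
    (GRing.isLinear.Build _ _ _ _ _ vec_mat_linear).
  have cF : continuous F by exact: linear_pair_mx_continuous vec_mat_linear.
  apply: DiffDef; first exact: (linear_differentiable (f := F)).
  exact: (diff_lin (f := F)).
have dq := is_diff_quadratic vec_ketbra_linearl vec_ketbra_linearr z.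
have hd := is_diffD (is_diffD (is_diff_scale dx (is_diff_cst vec1 z))
  (is_diff_scale dw dl)) (is_diff_scale dw3 dq).
have hs := is_diffZ ((-1) ^+ s) hd.
apply: (is_diff_eq hs); apply/funext => h.
rewrite to_vec_dcalabi_map; congr (_ *: (_ + _ + _)).
exact: (etrans (congr1 (+%R^~ _) (scaler0 _ _)) (add0r _)).
Qed.

End EmbeddingMap.

(** * Isometry and immersion *)

Section RankOneGeometry.
Variables (R : realType) (n : nat).
Local Notation C := R[i].
Local Notation M := 'M[C]_n.
Local Notation Re := (@complex.Re R).
Local Notation Im := (@complex.Im R).
Local Notation V := ('M[R]_n * 'M[R]_n)%type.
Local Notation N := ((n ^ 2 + 1) ^ 2)%N.
Implicit Types (q a b : M) (z h : V).

Lemma hs_norm_weight q : q != 0 -> hs_norm q = (weight q ^+ 2)^-1.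
Proof.
move=> q0; rewrite hs_normE -/(rdot q q) -/(nsq q) weightX4 //.
rewrite (_ : (weight q ^+ 4)^-1 = (weight q ^- 2) ^+ 2); last first.
  by rewrite -exprVn -exprVn -exprM.
by rewrite sqrtr_sqr ger0_norm // invr_ge0 exprn_ge0 // ltW ?weight_gt0.
Qed.

#[local] Opaque hs hs_op.

Lemma Re_hs_comb (k l k' l' : R) a b c d :
  Re (hs (k%:C%C *: a + l%:C%C *: b) (k'%:C%C *: c + l'%:C%C *: d)) =
  k * k' * Re (hs a c) + k * l' * Re (hs a d)
  + l * k' * Re (hs b c) + l * l' * Re (hs b d).
Proof.
rewrite hsDl !hsDr !hsZl !hsZr !conjC_rc.
move: (hs a c) (hs a d) (hs b c) (hs b d) => [? ?] [? ?] [? ?] [? ?] /=; ring.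
Qed.

Lemma Re_hs_op_comb (k l k' l' : R) (A B A' B' : 'End(M)) :
  Re (hs_op (k%:C%C *: A + l%:C%C *: B) (k'%:C%C *: A' + l'%:C%C *: B')) =
  k * k' * Re (hs_op A A') + k * l' * Re (hs_op A B')
  + l * k' * Re (hs_op B A') + l * l' * Re (hs_op B B').
Proof.
rewrite hs_opDl !hs_opDr !hs_opZl !hs_opZr !conjC_rc.
move: (hs_op A A') (hs_op A B') (hs_op B A') (hs_op B B').
by move=> [? ?] [? ?] [? ?] [? ?] /=; ring.
Qed.

Lemma hs_op_sym q a b :
  hs_op (ketbra q a + ketbra a q) (ketbra q b + ketbra b q) =
  hs q q * hs b a + hs q b * hs q a + (hs a q * hs b q + hs a b * hs q q).
Proof. by rewrite hs_opDl !hs_opDr !hs_op_ketbra. Qed.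

Lemma hs_op_sym_self q a :
  hs_op (ketbra q a + ketbra a q) (ketbra q q) =
  hs q q * hs q a + hs a q * hs q q.
Proof. by rewrite hs_opDl !hs_op_ketbra. Qed.

Lemma hs_op_self_sym q a :
  hs_op (ketbra q q) (ketbra q a + ketbra a q) =
  hs q q * hs a q + hs q a * hs q q.
Proof. by rewrite hs_opDr !hs_op_ketbra. Qed.

(** Writing r' for the derivative of r = ||q||, the products r'(a) r'(b) / r
    appear with the coefficients 5/8, - 3/4 and 1/8 in the three components and
    cancel; the rank-one operator supplies the term in the traces against q. *)
Lemma calabi_isometry q a b : q != 0 ->
  target_dot (dcalabi_map q a) (dcalabi_map q b) = calabi_metric q a b.
Proof.
move=> q0; have w0 := weight_gt0 q0; have m0 := weightX4 q0.
rewrite /target_dot /calabi_metric hs_norm_weight //= /dweight.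
rewrite Re_hs_comb Re_hs_op_comb hs_op_sym hs_op_sym_self hs_op_self_sym.
rewrite hs_op_ketbra ![rdot q _]rdotC /rdot (hsC a q) (hsC b q) (hsC a b).
move: m0; rewrite /nsq /rdot; have := Im_hs_self q.
move: (weight q) w0 => w w0.
move: (hs a q) (hs b q) (hs a b) (hs q q).
move=> [x x'] [y y'] [g g'] [m m'] /= -> ->.
by field; rewrite gt_eqF.
Qed.

(** In a full-rank factorization c d of an idempotent, the factors can be
    cancelled from c (d c) d = c d on both sides. *)
Lemma idempotent_factor r (c : 'M[C]_(n, r)) (d : 'M[C]_(r, n)) :
  row_full c -> row_free d -> (c *m d) *m (c *m d) = c *m d -> d *m c = 1%:M.
Proof.
move=> /row_fullP[B hB] fd cd; apply: (row_free_inj fd); rewrite /= mul1mx.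
rewrite -[LHS]mul1mx -[RHS]mul1mx -hB -[LHS]mulmxA -[RHS]mulmxA -cd.
by rewrite !mulmxA.
Qed.

Lemma mxtrace_idempotent q : q *m q = q -> \tr q = (\rank q)%:R.
Proof.
move=> qq; have -> : \tr q = \tr (col_base q *m row_base q).
  by rewrite mulmx_base.
rewrite mxtrace_mulC idempotent_factor ?mxtrace1 ?mulmx_base //.
  exact: col_base_full.
exact: row_base_free.
Qed.

Lemma rank1_projP q : rank1_proj q <-> q *m q = q /\ \tr q = 1.
Proof.
split=> -[qq h]; split=> //; first by rewrite mxtrace_idempotent // h.
by apply/eqP; rewrite -(eqr_nat C) -mxtrace_idempotent // h.
Qed.

Lemma rank1_proj_neq0 q : rank1_proj q -> q != 0.
Proof. by move=> [_ h]; rewrite -mxrank_eq0 h. Qed.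

Section Lines.
Variables q a : M.
Hypotheses (hq : rank1_proj q) (ha : tangent q a).

Lemma tangent_sandwich : q *m a *m q = 0.
Proof.
have [qq _] := hq; apply: (@addrI _ (q *m a)); rewrite addr0.
by rewrite -[in RHS]ha mulmxDr !mulmxA qq.
Qed.

Lemma tangent_trace : \tr (q *m a) = 0.
Proof.
have [qq _] := hq; rewrite -{1}qq -mulmxA mxtrace_mulC.
by rewrite tangent_sandwich mxtrace0.
Qed.

(** The projections with the image of [q], and those with its kernel, form
    affine spaces; a tangent vector is a sum of directions of these two
    spaces. *)
Lemma rank1_proj_line_image (t : C) : rank1_proj (q + t *: (q *m a)).
Proof.
have [qq tq] := (rank1_projP q).1 hq; apply/rank1_projP; split.
  rewrite mulmxDl !mulmxDr -!scalemxAr -!scalemxAl !mulmxA qq.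
  by rewrite tangent_sandwich mul0mx !scaler0 !addr0.
by rewrite mxtraceD mxtraceZ tangent_trace mulr0 addr0.
Qed.

Lemma rank1_proj_line_kernel (t : C) : rank1_proj (q + t *: (a *m q)).
Proof.
have [qq tq] := (rank1_projP q).1 hq; apply/rank1_projP; split.
  rewrite mulmxDl !mulmxDr -!scalemxAr -!scalemxAl -!mulmxA qq.
  by rewrite [q *m (a *m q)]mulmxA tangent_sandwich mulmx0 !scaler0 !addr0.
by rewrite mxtraceD mxtraceZ mxtrace_mulC tangent_trace mulr0 addr0.
Qed.

End Lines.

(** If X contains the line through x in the direction v, a function has no
    freedom in that direction once its values on X are given. *)
Lemma diff_along_line (V' W' : normedModType R) (X U : set V') (f G : V' -> W')
    (x v : V') :
  open U -> U x -> (forall y, U y -> X y -> G y = f y) ->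
  differentiable f x -> differentiable G x ->
  (forall t : R, X (x + t *: v)) -> 'd G x v = 'd f x v.
Proof.
move=> oU Ux Gf /differentiableP df /differentiableP dG Xv.
pose l (t : R) := x + t *: v.
have l0 : l 0 = x by rewrite /l scale0r addr0.
have dl : is_diff 0 l (fun t => t *: v).
  have hd := is_diffD (is_diff_cst x (0 : R))
    (is_diff_scale (is_diff_id (0 : R)) (is_diff_cst v (0 : R))).
  apply: (is_diff_eq hd); apply/funext => t.
  by rewrite -[LHS]/(0 + (0 *: 0 + t *: v)) scale0r !add0r.
have cl : continuous l.
  move=> t; apply: cvgD; first exact: cvg_cst.
  by apply: cvgZr_tmp; exact: cvg_id.
have oV : open (l @^-1` U) by apply: open_comp => // t _; exact: cl.
have V0 : (l @^-1` U) 0 by rewrite /= l0.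
rewrite -l0 in df dG.
have cf := is_diff_comp dl df; have cG := is_diff_comp dl dG.
have dGl : differentiable (G \o l) 0 by exact: ex_diff.
have Gfl t : (l @^-1` U) t -> (G \o l) t = (f \o l) t.
  by move=> Ut; exact: Gf Ut (Xv t).
have [_ e] := differentiable_ext oV V0 Gfl dGl.
have eG : 'd (G \o l) 0 1 = 'd G x v.
  by rewrite (is_diffE _ cG) /= scale1r l0.
have ef : 'd (f \o l) 0 1 = 'd f x v.
  by rewrite (is_diffE _ cf) /= scale1r l0.
by rewrite -eG -ef e.
Qed.

Lemma to_realD q a : to_real (q + a) = to_real q + to_real a.
Proof.
by congr (_, _); apply/matrixP => i j; rewrite !mxE (ReD, ImD).
Qed.

Lemma to_realZ (t : R) q : to_real (t%:C%C *: q) = t *: to_real q.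
Proof.
congr (_, _); apply/matrixP => i j; rewrite !mxE.
  by rewrite ReM /= mul0r subr0.
by rewrite ImM /= mul0r addr0.
Qed.

Lemma nz_rank1 q : rank1_proj q -> nz (to_real q).
Proof. by move=> hq; rewrite /nz /= to_realK rank1_proj_neq0. Qed.

(** A tangent vector is a sum q a + a q of the directions of two lines inside
    the manifold, which determines the differential of any extension. *)
Lemma extension_diff q a s G : rank1_proj q -> tangent q a ->
  smooth_extension (@rank1_real R n) (sheet (@embed R n) s) (to_real q) G ->
  'd G (to_real q) (to_real a) = (-1) ^+ s *: to_vec (dcalabi_map q a).
Proof.
move=> hq ha [U [oU Uq sG Gf]].
have [dG _] := sG 1%N.
have hd := is_diff_sheet_embed s (nz_rank1 hq).
have df : differentiable (sheet (@embed R n) s) (to_real q) by exact: ex_diff.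
have line b : (forall t : C, rank1_proj (q + t *: b)) ->
    'd G (to_real q) (to_real b) =
    'd (sheet (@embed R n) s) (to_real q) (to_real b).
  move=> hb; apply: (diff_along_line oU Uq Gf df (dG _ Uq)) => t.
  by exists (q + t%:C%C *: b); [exact: hb | rewrite to_realD to_realZ].
have -> : to_real a = to_real (q *m a) + to_real (a *m q).
  by rewrite -to_realD ha.
apply: (etrans (linearD ('d G (to_real q)) _ _)).
have e1 := line _ (rank1_proj_line_image hq ha).
have e2 := line _ (rank1_proj_line_kernel hq ha).
apply: (etrans (congr2 +%R e1 e2)).
apply: (etrans (esym (linearD ('d (sheet (@embed R n) s) (to_real q)) _ _))).
by rewrite -to_realD ha; apply: (etrans (is_diffE _ hd)); rewrite !to_realK.
Qed.

Lemma embed_smooth s : smooth_on (@rank1_real R n) (sheet (@embed R n) s).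
Proof.
move=> z [q hq <-]; exists (sheet (@embed R n) s), (@nz R n); split=> //.
- exact: nz_open.
- exact: nz_rank1.
- by move=> k; exact: Ck_sheet_embed.
Qed.

Lemma euclid_dot_sign m (s : bool) (u v : 'rV[R]_m) :
  euclid_dot ((-1) ^+ s *: u) ((-1) ^+ s *: v) = euclid_dot u v.
Proof.
apply: eq_bigr => i _; rewrite !mxE mulrACA -expr2 sqrr_sign.
by rewrite mul1r.
Qed.

Lemma embed_isometric : isometric (@embed R n).
Proof.
move=> q s G hq hG a b ha hb.
rewrite (extension_diff hq ha hG) (extension_diff hq hb hG).
rewrite -calabi_isometry ?rank1_proj_neq0 // euclid_dot_sign.
apply: to_vec_dot; exact: dcalabi_map_selfadjoint.
Qed.

Lemma of_vec0 : of_vec (0 : 'rV[R]_N) = (0, 0, 0).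
Proof.
by rewrite -(scale0r (0 : 'rV[R]_N)) of_vecZ mul0r !scale0r.
Qed.

(** The scalar component of the differential detects the derivative of ||q||;
    once that vanishes, the matrix component is a positive multiple of the
    direction. *)
Lemma embed_immersive : immersive (@embed R n).
Proof.
move=> q s G hq hG a ha; rewrite (extension_diff hq ha hG) => /eqP.
rewrite scaler_eq0 signr_eq0 /= => /eqP e.
have := to_vecK (dcalabi_map_selfadjoint q a); rewrite e of_vec0.
have w0 := weight_gt0 (rank1_proj_neq0 hq).
move=> [e1 e2 _]; have r0 : rdot q a = 0.
  apply/eqP; move/esym/eqP: e1; rewrite mulf_eq0 invr_eq0 pnatr_eq0 orbF.
  by rewrite mulf_eq0 expf_eq0 (gt_eqF w0) /=.
move: e2; rewrite /dweight r0 mulr0 scale0r addr0 => /esym/eqP.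
by rewrite scaler_eq0 => /orP[/eqP/complexI|/eqP//] w00; rewrite w00 ltxx in w0.
Qed.

End RankOneGeometry.

(** * Equivariance *)

Section Equivariance.
Variables (R : realType) (n : nat).
Local Notation C := R[i].
Local Notation M := 'M[C]_n.
Local Notation N := ((n ^ 2 + 1) ^ 2)%N.
Implicit Types (q a b U : M) (p : 'End(M)).

#[local] Opaque hs hs_op.

Definition signed (s : bool) (t : target R n) : target R n :=
  if s then (- t.1.1, - t.1.2, - t.2) else t.

Lemma of_vec_embed q s : of_vec (embed (q, s)) = signed s (calabi_map q).
Proof.
have e := to_vecK (calabi_map_selfadjoint q).
rewrite /embed of_vecZ e; case: s => /=; last first.
  by rewrite expr0 mul1r !scale1r.
by rewrite expr1 mulN1r rmorphN1 !scaleN1r.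
Qed.

Lemma signed_addb s s' t : signed (s (+) s') t = signed s' (signed s t).
Proof.
by case: s s' t => [] [] [[x q] p] //=; rewrite /signed /= !opprK.
Qed.

Lemma AdE U T : Ad U T = (U *m T *m U ^t*)%sesqui.
Proof.
have lA : linear (fun T : M => (U *m T *m U ^t*)%sesqui).
  by move=> k S T'; rewrite mulmxDr mulmxDl -scalemxAr -scalemxAl.
pose f : {linear M -> M} := HB.pack (fun T : M => (U *m T *m U ^t*)%sesqui)
  (GRing.isLinear.Build _ _ _ _ _ lA).
exact: (lfunE f).
Qed.

Lemma op_daggerE p T : op_dagger p T = ((p (T ^t*)) ^t*)%sesqui.
Proof.
have lA : linear (fun T : M => ((p (T ^t*)) ^t*)%sesqui).
  move=> k S T'; have -> : ((k *: S + T') ^t* = k^* *: S ^t* + T' ^t*)%sesqui.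
    by apply/matrixP => i j; rewrite !mxE rmorphD rmorphM.
  rewrite linearD linearZ; apply/matrixP => i j.
  by rewrite !mxE rmorphD rmorphM /= conjCK.
pose f : {linear M -> M} := HB.pack (fun T : M => ((p (T ^t*)) ^t*)%sesqui)
  (GRing.isLinear.Build _ _ _ _ _ lA).
exact: (lfunE f).
Qed.

Lemma AdVE U T : U \is unitarymx ->
  (Ad U)^-1%VF T = (U ^t* *m T *m U)%sesqui.
Proof.
move=> uU; have uV := unitary_adjK uU; have uU' : (U *m U ^t* = 1%:M)%sesqui.
  by apply/unitarymxP.
have k0 : lker (Ad U) == 0%VS.
  apply/lker0P => S S'; rewrite !AdE.
  move=> /(congr1 (fun X => U ^t* *m X *m U)%sesqui).
  by rewrite !mulmxA uV !mul1mx -!mulmxA uV !mulmx1.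
have inj : injective (Ad U) by exact/lker0P.
apply: inj; rewrite lker0_lfunVK // AdE.
by rewrite !mulmxA uU' mul1mx -mulmxA uU' mulmx1.
Qed.

Lemma ketbra_conj U q : U \is unitarymx ->
  ketbra (U *m q *m U ^t*)%sesqui (U *m q *m U ^t*)%sesqui
  = (Ad U \o ketbra q q \o (Ad U)^-1)%VF.
Proof.
move=> uU; apply/lfunP => T; rewrite ketbraE !comp_lfunE AdVE // AdE ketbraE.
rewrite -scalemxAr -scalemxAl; congr (_ *: _).
rewrite -[RHS](hs_conj _ _ uU); congr (hs _ _).
have uU' : (U *m U ^t* = 1%:M)%sesqui by apply/unitarymxP.
by rewrite !mulmxA uU' mul1mx -mulmxA uU' mulmx1.
Qed.

Lemma ketbra_dagger q :
  (ketbra (q ^t*) (q ^t*))%sesqui = op_dagger (ketbra q q).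
Proof.
apply/lfunP => T; rewrite op_daggerE !ketbraE.
have -> (k : C) : ((k *: q) ^t* = k^* *: q ^t*)%sesqui.
  by apply/matrixP => i j; rewrite !mxE rmorphM.
by rewrite -hs_adj trmxCK.
Qed.

Lemma op_daggerZ (k : R) p : op_dagger (k%:C%C *: p) = k%:C%C *: op_dagger p.
Proof.
apply/lfunP => T; rewrite op_daggerE !scale_lfunE op_daggerE.
by apply/matrixP => i j; rewrite !mxE rmorphM /= conjC_rc.
Qed.

Lemma nsq_conj U q : U \is unitarymx -> nsq (U *m q *m U ^t*)%sesqui = nsq q.
Proof. by move=> uU; rewrite /nsq /rdot hs_conj. Qed.

Lemma nsq_adj q : nsq (q ^t*)%sesqui = nsq q.
Proof. by rewrite /nsq /rdot hs_adj ReJ. Qed.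

Lemma calabi_map_conj U q : U \is unitarymx ->
  calabi_map (U *m q *m U ^t*)%sesqui =
  ((calabi_map q).1.1, (U *m (calabi_map q).1.2 *m U ^t*)%sesqui,
   (Ad U \o (calabi_map q).2 \o (Ad U)^-1)%VF).
Proof.
move=> uU; rewrite /calabi_map /weight nsq_conj // ketbra_conj //=.
congr (_, _, _); first by rewrite -scalemxAr -scalemxAl.
by rewrite -comp_lfunZr -comp_lfunZl.
Qed.

Lemma calabi_map_adj q :
  calabi_map (q ^t*)%sesqui =
  ((calabi_map q).1.1, ((calabi_map q).1.2 ^t*)%sesqui,
   op_dagger (calabi_map q).2).
Proof.
rewrite /calabi_map /weight nsq_adj ketbra_dagger op_daggerZ /=.
congr (_, _, _); apply/matrixP => i j.
by rewrite !mxE rmorphM /= conjC_rc.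
Qed.

Lemma op_daggerN p : op_dagger (- p) = - op_dagger p.
Proof.
apply/lfunP => T; rewrite op_daggerE !opp_lfunE op_daggerE.
by apply/matrixP => i j; rewrite !mxE rmorphN.
Qed.

Lemma adjN (b : M) : ((- b) ^t* = - b ^t*)%sesqui.
Proof. by apply/matrixP => i j; rewrite !mxE rmorphN. Qed.

Lemma act_target_signed U e1 e2 s t :
  act_target U e1 e2 (signed s t) =
  signed e2 (signed s (act_target U e1 false t)).
Proof.
case: t => [[x q] p]; case: s; case: e1; case: e2;
  rewrite /signed /act_target //=;
by rewrite ?op_daggerN ?adjN ?mulmxN ?mulNmx ?comp_lfunNr ?comp_lfunNl ?opprK.
Qed.

Lemma embed_equivariant : equivariant (@of_vec R n) (@embed R n).
Proof.
move=> U e1 e2 [q s] [uU _] _.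
have -> : act_source U e1 e2 (q, s) =
  ((U *m (if e1 then q ^t* else q) *m U ^t*)%sesqui, s (+) e2) by [].
apply: (etrans (of_vec_embed _ _)).
have -> : of_vec (embed (q, s)) = signed s (calabi_map q).
  exact: of_vec_embed.
rewrite act_target_signed signed_addb; congr (signed _ (signed _ _)).
by rewrite calabi_map_conj //; case: e1; rewrite /act_target // calabi_map_adj.
Qed.

End Equivariance.

(** * Polynomial equations of the image *)

Section Polynomials.
Import -(notations) mpoly.
Variables (R : realType) (m : nat).
Local Notation C := R[i].
Local Notation Re := (@complex.Re R).
Local Notation Im := (@complex.Im R).
Implicit Types (f g : 'rV[R]_m -> R) (F G : 'rV[R]_m -> C).

Definition polynomial_map f : Prop :=
  exists p : mpoly m R, forall y, f y = meval (fun i => y ord0 i) p.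

Lemma polynomial_cst (k : R) : polynomial_map (fun=> k).
Proof. by exists (mpolyC m k) => y; rewrite mevalC. Qed.

Lemma polynomialD f g : polynomial_map f -> polynomial_map g ->
  polynomial_map (fun y => f y + g y).
Proof. by move=> [p hp] [q hq]; exists (p + q) => y; rewrite mevalD hp hq. Qed.

Lemma polynomialM f g : polynomial_map f -> polynomial_map g ->
  polynomial_map (fun y => f y * g y).
Proof. by move=> [p hp] [q hq]; exists (p * q) => y; rewrite mevalM hp hq. Qed.

Lemma polynomial_ext f g : f =1 g -> polynomial_map f -> polynomial_map g.
Proof. by move=> fg [p hp]; exists p => y; rewrite -fg. Qed.

Lemma polynomialN f : polynomial_map f -> polynomial_map (fun y => - f y).
Proof.
move=> hf; apply: polynomial_ext (polynomialM (polynomial_cst (-1)) hf) => y.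
by rewrite mulN1r.
Qed.

Lemma polynomial_sum (I : Type) (r : seq I) (h : I -> 'rV[R]_m -> R) :
  (forall i, polynomial_map (h i)) ->
  polynomial_map (fun y => \sum_(i <- r) h i y).
Proof.
move=> hh; elim: r => [|i r IHr].
  by apply: polynomial_ext (polynomial_cst 0) => y; rewrite big_nil.
by apply: polynomial_ext (polynomialD (hh i) IHr) => y; rewrite big_cons.
Qed.

Lemma polynomial_linear f :
  (forall x y, f (x + y) = f x + f y) -> (forall k x, f (k *: x) = k * f x) ->
  polynomial_map f.
Proof.
move=> fD fZ; have f0 : f 0 = 0 by rewrite -(scale0r 0) fZ mul0r.
have coordP i : polynomial_map (fun y => f (delta_mx 0 i) * y ord0 i).
  apply: polynomialM; first exact: polynomial_cst.
  by exists (mpolyX R (mnm1 i)) => y; rewrite mevalXU.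
apply: polynomial_ext (polynomial_sum (index_enum _) coordP) => y.
rewrite [in RHS](row_sum_delta y) (big_morph f fD f0).
by apply: eq_bigr => i _; rewrite fZ mulrC.
Qed.

Definition complex_polynomial_map F : Prop :=
  polynomial_map (fun y => Re (F y)) /\ polynomial_map (fun y => Im (F y)).

Lemma complex_polynomial_cst (k : C) : complex_polynomial_map (fun=> k).
Proof. by split; exact: polynomial_cst. Qed.

Lemma complex_polynomial_real f : polynomial_map f ->
  complex_polynomial_map (fun y => (f y)%:C%C).
Proof. by move=> hf; split=> //; exact: polynomial_cst. Qed.

Lemma complex_polynomialM F G : complex_polynomial_map F ->
  complex_polynomial_map G -> complex_polynomial_map (fun y => F y * G y).
Proof.
move=> [rF iF] [rG iG]; split.
  apply: polynomial_ext (polynomialD (polynomialM rF rG)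
    (polynomialN (polynomialM iF iG))) => y.
  by rewrite ReM.
apply: polynomial_ext (polynomialD (polynomialM rF iG)
  (polynomialM iF rG)) => y.
by rewrite ImM.
Qed.

Lemma complex_polynomialJ F : complex_polynomial_map F ->
  complex_polynomial_map (fun y => (F y)^*).
Proof.
move=> [rF iF]; split.
  by apply: polynomial_ext rF => y; rewrite ReJ.
by apply: polynomial_ext (polynomialN iF) => y; rewrite ImJ.
Qed.

Lemma complex_polynomial_sum (I : Type) (r : seq I) (h : I -> 'rV[R]_m -> C) :
  (forall i, complex_polynomial_map (h i)) ->
  complex_polynomial_map (fun y => \sum_(i <- r) h i y).
Proof.
move=> hh; split.
  have hr i : polynomial_map (fun y => Re (h i y)) by case: (hh i).
  by apply: polynomial_ext (polynomial_sum r hr) => y; rewrite Re_sum.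
have hi i : polynomial_map (fun y => Im (h i y)) by case: (hh i).
by apply: polynomial_ext (polynomial_sum r hi) => y; rewrite Im_sum.
Qed.

(** Over the reals a sum of squares vanishes only if all terms do, so one
    equation suffices for a finite system. *)
Definition hypersurface (A : set 'rV[R]_m) : Prop :=
  exists2 f, polynomial_map f & forall y, A y <-> f y = 0.

Lemma hypersurface_forall (I : finType) (A : I -> set 'rV[R]_m) :
  (forall i, hypersurface (A i)) -> hypersurface [set y | forall i, A i y].
Proof.
move=> hA; pose h i := projT1 (cid2 (hA i)).
have hP i : polynomial_map (h i) by rewrite /h; case: cid2.
have hE i y : A i y <-> h i y = 0 by rewrite /h; case: cid2.
exists (fun y => \sum_i h i y * h i y).
  by apply: polynomial_sum => i; exact: polynomialM.
move=> y; split=> [Ay|/eqP].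
  by apply: big1 => i _; rewrite (iffLR (hE i y) (Ay i)) mul0r.
rewrite psumr_eq0 => [/allP h0 i|i _]; last by rewrite -expr2 sqr_ge0.
apply/hE/eqP; have := h0 i (mem_index_enum i).
by rewrite /= -expr2 sqrf_eq0.
Qed.

Lemma hypersurface_ext (A B : set 'rV[R]_m) : (forall y, A y <-> B y) ->
  hypersurface A -> hypersurface B.
Proof. by move=> AB [f pf fE]; exists f => // y; rewrite -AB. Qed.

Lemma hypersurfaceI (A B : set 'rV[R]_m) : hypersurface A -> hypersurface B ->
  hypersurface (A `&` B).
Proof.
move=> hA hB; have h := @hypersurface_forall bool (fun b => if b then A else B).
apply: hypersurface_ext (h _) => [y|[]] //.
by split=> [AB|[Ay By] []//]; split; [exact: (AB true) | exact: (AB false)].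
Qed.

Lemma hypersurface_eq F G : complex_polynomial_map F ->
  complex_polynomial_map G -> hypersurface [set y | F y = G y].
Proof.
move=> [rF iF] [rG iG].
have hr := polynomialD rF (polynomialN rG).
have hi := polynomialD iF (polynomialN iG).
apply: (hypersurface_ext (A := [set y | Re (F y) - Re (G y) = 0] `&`
  [set y | Im (F y) - Im (G y) = 0])).
  move=> y; split=> [[/= /subr0_eq e1 /subr0_eq e2]|/= ->].
    exact: complexP.
  by split; rewrite /= subrr.
by apply: hypersurfaceI; [exists (fun y => Re (F y) - Re (G y)) |
  exists (fun y => Im (F y) - Im (G y))].
Qed.

Lemma hypersurface_variety A : hypersurface A -> real_affine_variety A.
Proof.
move=> [f [p hp] fE]; exists 1%N, (fun=> p); apply/seteqP; split=> y /=.
  by move=> /fE fy _; rewrite -hp.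
by move=> h; apply/fE; rewrite hp; exact: (h ord0).
Qed.

End Polynomials.

Section ImageEquations.
Variables (R : realType) (n : nat).
Local Notation C := R[i].
Local Notation M := 'M[C]_n.
Local Notation Re := (@complex.Re R).
Local Notation Im := (@complex.Im R).
Local Notation N := ((n ^ 2 + 1) ^ 2)%N.
Implicit Types (q : M) (t : target R n) (y : 'rV[R]_N).

#[local] Opaque hs hs_op of_vec to_vec.

Lemma lfun_delta_ext (p p' : 'End(M)) :
  (forall i j k l, p (delta_mx i j) k l = p' (delta_mx i j) k l) -> p = p'.
Proof.
move=> e; rewrite -[LHS]mxop_lin_mx -[RHS]mxop_lin_mx; congr mxop.
apply/matrixP => x y; case/mxvec_indexP: x => i j; case/mxvec_indexP: y => k l.
by rewrite !lin_mx_lfunE.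
Qed.

(** For (x, b, p) these equations say that q = x b is idempotent of trace 1,
    that ||q|| = x^2, and that p = |b><b| / x.  They are invariant under a
    change of sign of (x, b, p), which exchanges the two copies. *)
Definition on_image t : Prop :=
  let x := t.1.1%:C%C in let b := t.1.2 in
  [/\ (x * x) *: (b *m b) = x *: b, x * \tr b = 1, hs b b = x * x &
      x *: t.2 = ketbra b b].

Lemma on_image_signed s t : on_image (signed s t) <-> on_image t.
Proof.
case: s => //; rewrite /signed /on_image /=; case: t => [[x b] p] /=.
rewrite rmorphN mulrNN mulNmx mulmxN opprK !scalerN !scaleNr !opprK.
have -> : hs (- b) (- b) = hs b b.
  by rewrite -(scaleN1r b) hsZl hsZr rmorphN1 !mulN1r opprK.
have -> : ketbra (- b) (- b) = ketbra b b.
  by rewrite -(scaleN1r b) ketbraZl ketbraZr rmorphN1 !scaleN1r opprK.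
by rewrite raddfN /= mulrNN.
Qed.

Lemma calabi_map_on_image q : rank1_proj q ->
  on_image (calabi_map q) /\ 0 < (calabi_map q).1.1.
Proof.
move=> hq; have q0 := rank1_proj_neq0 hq; have [qq tq] := (rank1_projP q).1 hq.
have w0 := weight_gt0 q0; have m0 := weightX4 q0.
have x1 : (calabi_map q).1.1 = (weight q)^-1.
  by rewrite /= m0; field; rewrite gt_eqF.
have wC : (weight q)%:C%C != 0 :> C by rewrite fmorph_eq0 gt_eqF.
split; last by rewrite x1 invr_gt0.
rewrite /on_image x1 fmorphV /=; split.
- rewrite -scalemxAl -scalemxAr !scalerA qq; congr (_ *: _); by field.
- by rewrite mxtraceZ tq mulr1 mulVf.
- rewrite hsZl hsZr conjC_rc.
  have -> : hs q q = (weight q)%:C%C ^- 4.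
    apply: complexP; last by rewrite Im_hs_self -rmorphXn -fmorphV.
    by rewrite -/(rdot q q) -/(nsq q) m0 -rmorphXn -fmorphV.
  by field.
- rewrite ketbraZl ketbraZr conjC_rc !scalerA rmorphXn.
  congr (_ *: _); by field.
Qed.

Lemma on_image_calabi_map t : on_image t -> 0 < t.1.1 ->
  rank1_proj (t.1.1%:C%C *: t.1.2) /\ calabi_map (t.1.1%:C%C *: t.1.2) = t.
Proof.
case: t => [[x b] p] [/= bb tb hb hp] x0.
have xC : x%:C%C != 0 :> C by rewrite fmorph_eq0 gt_eqF.
have hq : rank1_proj (x%:C%C *: b).
  apply/rank1_projP; split; last by rewrite mxtraceZ.
  by rewrite -scalemxAl -scalemxAr scalerA.
have q0 := rank1_proj_neq0 hq.
split=> //; have m4 : nsq (x%:C%C *: b) = x ^+ 4.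
  rewrite /nsq /rdot hsZl hsZr conjC_rc hb -!rmorphM /=; ring.
have wE : weight (x%:C%C *: b) = x^-1.
  have w0 := weight_gt0 q0; have := weightX4 q0; rewrite m4.
  move=> /(congr1 GRing.inv); rewrite invrK -exprVn => /eqP.
  by rewrite eq_sym eqrXn2 ?invr_ge0 ?ltW // => /eqP.
rewrite /calabi_map m4 wE; congr (_, _, _).
- by field; rewrite gt_eqF.
- by rewrite scalerA -rmorphM mulVf ?gt_eqF // scale1r.
rewrite ketbraZl ketbraZr conjC_rc -hp !scalerA -!rmorphM.
by rewrite (_ : _ * x = 1) ?scale1r //; field; rewrite gt_eqF.
Qed.

Lemma signed_gt0 t : t.1.1 != 0 -> 0 < (signed (t.1.1 < 0) t).1.1.
Proof.
rewrite neq_lt => /orP[] h; rewrite /signed; first by rewrite h oppr_gt0.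
by rewrite (lt_gtF h).
Qed.

(** The trace equation excludes x = 0, and the sign of x tells which copy is
    reached. *)
Lemma image_embedE : @embed R n @` @source R n = [set y | on_image (of_vec y)].
Proof.
apply/seteqP; split=> [_ [[q s] [hq _] <-]|y /= hy].
  rewrite /= of_vec_embed; apply/on_image_signed.
  by have [] := calabi_map_on_image hq.
pose t := of_vec y; pose s := t.1.1 < 0; pose t' := signed s t.
have x0 : t.1.1 != 0.
  case: hy => _ h _ _; apply: contra_eq_neq h => x0.
  by rewrite -/t x0 mul0r eq_sym oner_neq0.
have t'0 : 0 < t'.1.1 by exact: signed_gt0.
have [hq e] : _ /\ _ := on_image_calabi_map ((on_image_signed s t).2 hy) t'0.
exists (t'.1.1%:C%C *: t'.1.2, s); first by [].
apply: (can_inj (@of_vecK R n)); rewrite of_vec_embed e /t' -signed_addb addbb.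
by [].
Qed.

Lemma image_variety : real_affine_variety (@embed R n @` @source R n).
Proof.
apply: hypersurface_variety; rewrite image_embedE.
have px : complex_polynomial_map (fun y => ((of_vec y).1.1)%:C%C : C).
  apply: complex_polynomial_real; apply: polynomial_linear => [y y'|k y].
    by rewrite of_vecD.
  by rewrite of_vecZ.
have pb i j : complex_polynomial_map (fun y => (of_vec y).1.2 i j : C).
  split; apply: polynomial_linear => [y y'|k y].
  - by rewrite of_vecD mxE ReD.
  - by rewrite of_vecZ mxE ReM /= mul0r subr0.
  - by rewrite of_vecD mxE ImD.
  - by rewrite of_vecZ mxE ImM /= mul0r addr0.
have pp i j k l : complex_polynomial_map
    (fun y => (of_vec y).2 (delta_mx i j) k l : C).
  split; apply: polynomial_linear => [y y'|c y].
  - by rewrite of_vecD add_lfunE mxE ReD.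
  - by rewrite of_vecZ scale_lfunE mxE ReM /= mul0r subr0.
  - by rewrite of_vecD add_lfunE mxE ImD.
  - by rewrite of_vecZ scale_lfunE mxE ImM /= mul0r addr0.
have h1 : hypersurface [set y : 'rV[R]_N | forall i j,
    ((of_vec y).1.1%:C%C * (of_vec y).1.1%:C%C) *
      (\sum_k (of_vec y).1.2 i k * (of_vec y).1.2 k j) =
    (of_vec y).1.1%:C%C * (of_vec y).1.2 i j].
  apply: hypersurface_forall => i; apply: hypersurface_forall => j.
  apply: hypersurface_eq; last exact: complex_polynomialM.
  apply: complex_polynomialM; first exact: complex_polynomialM.
  by apply: complex_polynomial_sum => k; exact: complex_polynomialM.
have h2 : hypersurface [set y : 'rV[R]_N |
    (of_vec y).1.1%:C%C * (\sum_i (of_vec y).1.2 i i) = 1].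
  apply: hypersurface_eq; last exact: complex_polynomial_cst.
  by apply: complex_polynomialM => //; exact: complex_polynomial_sum.
have h3 : hypersurface [set y : 'rV[R]_N |
    \sum_i \sum_j (of_vec y).1.2 i j * ((of_vec y).1.2 i j)^* =
    (of_vec y).1.1%:C%C * (of_vec y).1.1%:C%C].
  apply: hypersurface_eq; last exact: complex_polynomialM.
  apply: complex_polynomial_sum => i; apply: complex_polynomial_sum => j.
  by apply: complex_polynomialM => //; exact: complex_polynomialJ.
have h4 : hypersurface [set y : 'rV[R]_N | forall i j k l,
    (of_vec y).1.1%:C%C * (of_vec y).2 (delta_mx i j) k l =
    ((of_vec y).1.2 i j)^* * (of_vec y).1.2 k l].
  apply: hypersurface_forall => i; apply: hypersurface_forall => j.
  apply: hypersurface_forall => k; apply: hypersurface_forall => l.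
  apply: hypersurface_eq; first exact: complex_polynomialM.
  by apply: complex_polynomialM => //; exact: complex_polynomialJ.
apply: hypersurface_ext
  (hypersurfaceI (hypersurfaceI h1 h2) (hypersurfaceI h3 h4)) => y.
rewrite /on_image /=; move: (of_vec y) => [[x b] p] /=; split.
  move=> [[e1 e2] [e3 e4]]; split.
  - by apply/matrixP => i j; rewrite !mxE e1.
  - exact: e2.
  - by rewrite hsE.
  - apply: lfun_delta_ext => i j k l; rewrite scale_lfunE ketbraE hsC hs_delta.
    by rewrite !mxE e4.
move=> [e1 e2 e3 e4]; split; split.
- by move=> i j; have := congr1 (fun A : M => A i j) e1; rewrite !mxE.
- exact: e2.
- by rewrite -e3 hsE.
- move=> i j k l; have := congr1 (fun A : 'End(M) => A (delta_mx i j) k l) e4.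
  by rewrite scale_lfunE ketbraE hsC hs_delta !mxE.
Qed.

End ImageEquations.

(** * The continuous inverse *)

Section Inverse.
Variables (R : realType) (n : nat).
Local Notation C := R[i].
Local Notation M := 'M[C]_n.
Local Notation V := ('M[R]_n * 'M[R]_n)%type.
Local Notation N := ((n ^ 2 + 1) ^ 2)%N.
Implicit Types (q : M) (y : 'rV[R]_N).

#[local] Opaque hs hs_op of_vec to_vec.

Definition unembed y : V * bool :=
  let t := of_vec y in (to_real (t.1.1%:C%C *: t.1.2), t.1.1 < 0).

Lemma embedK q s : rank1_proj q -> unembed (embed (q, s)) = (to_real q, s).
Proof.
move=> hq; have q0 := rank1_proj_neq0 hq.
have w0 := weight_gt0 q0; have m0 := weightX4 q0.
have x1 : nsq q * weight q ^+ 3 = (weight q)^-1.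
  by rewrite m0; field; rewrite gt_eqF.
rewrite /unembed of_vec_embed.
have xq : (calabi_map q).1.1%:C%C *: (calabi_map q).1.2 = q.
  by rewrite /= x1 scalerA -rmorphM mulVf ?gt_eqF // scale1r.
have x0 : 0 < (calabi_map q).1.1 by rewrite /= x1 invr_gt0.
case: s; rewrite /signed.
  by rewrite rmorphN scalerN scaleNr opprK xq oppr_lt0 x0.
by rewrite xq lt_gtF.
Qed.

Lemma linear_rV_continuous (W : normedModType R) (m : nat) (f : 'rV[R]_m -> W) :
  linear f -> continuous f.
Proof.
move=> lf y.
(* row vectors sit among pairs of matrices as first components *)
pose F (z : 'rV[R]_m * 'rV[R]_m) := f z.1.
have lF : linear F by move=> k x z; rewrite /F lf.
have cF := linear_pair_mx_continuous lF.
pose i (u : 'rV[R]_m) : 'rV[R]_m * 'rV[R]_m := (u, 0).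
have -> : f = F \o i by [].
apply: continuous_comp; last exact: cF.
have di := is_diff_pair (is_diff_id y) (is_diff_cst (0 : 'rV[R]_m) y).
apply: differentiable_continuous; exact: ex_diff.
Qed.

Lemma sign_continuous (T : topologicalType) (f : T -> R) (y0 : T) :
  f x @[x --> y0] --> f y0 -> f y0 != 0 ->
  (f x < 0) @[x --> y0] --> (f y0 < 0).
Proof.
move=> cf f0; apply: cvg_near_cst; move: f0; rewrite neq_lt => /orP[] h.
  by near=> u; rewrite h; near: u; exact: (cvgr_lt _ cf).
near=> u; have fu : 0 < f u by near: u; exact: (cvgr_gt _ cf).
by rewrite (lt_gtF fu) (lt_gtF h).
Unshelve. all: by end_near. Qed.

(** On the image the trace equation keeps x away from 0, so the sign of x is
    locally constant there. *)
Lemma unembed_continuous :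
  {within @embed R n @` @source R n, continuous unembed}.
Proof.
apply: continuous_in_subspaceT => y; rewrite inE image_embedE => -[_ tr1 _ _].
have x0 : (of_vec y).1.1 != 0.
  by apply: contra_eq_neq tr1 => ->; rewrite mul0r eq_sym oner_neq0.
have lx : linear (fun y : 'rV[R]_N => (of_vec y).1.1 : R).
  by move=> k u v; rewrite of_vecD of_vecZ.
have lb : linear (fun y : 'rV[R]_N => to_real (of_vec y).1.2 : V).
  by move=> k u v; rewrite of_vecD of_vecZ to_realD to_realZ.
have cx := linear_rV_continuous lx; have cb := linear_rV_continuous lb.
have c1 : (of_vec u).1.1 *: (to_real (of_vec u).1.2 : V) @[u --> y] -->
    (of_vec y).1.1 *: (to_real (of_vec y).1.2 : V).
  exact: (@CkZ _ _ _ openT _ 0 _ _ (fun u _ => cx u) (fun u _ => cb u) y I).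
have c2 := sign_continuous (cx y) x0.
have -> : unembed = fun u : 'rV[R]_N =>
    ((of_vec u).1.1 *: (to_real (of_vec u).1.2 : V), (of_vec u).1.1 < 0).
  by apply/funext => u; rewrite /unembed to_realZ.
exact: cvg_pair c1 c2.
Qed.

Lemma embed_smooth_embedding : smooth_embedding (@embed R n).
Proof.
split.
- exact: embed_smooth.
- exact: embed_immersive.
- move=> [q s] [q' s']; rewrite !inE => -[hq _] [hq' _] e.
  have eqs := etrans (esym (embedK s hq))
    (etrans (congr1 unembed e) (embedK s' hq')).
  have ss : s = s' := congr1 (fun z => z.2) eqs.
  have qq : to_real q = to_real q' := congr1 (fun z => z.1) eqs.
  by rewrite ss (can_inj (@to_realK R n) qq).
- exists unembed; split; last exact: unembed_continuous.
  by move=> q s; exact: embedK.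
Qed.

End Inverse.

Theorem corollary6p0p4 (R : realType) (n : nat) (hn : (1 < n)%N) :
  exists L : 'rV[R]_((n ^ 2 + 1) ^ 2) -> target R n,
    isometric_identification L /\
    exists F : 'M[R[i]]_n * bool -> 'rV[R]_((n ^ 2 + 1) ^ 2),
      [/\ smooth_embedding F,
          isometric F,
          equivariant L F &
          real_affine_variety (F @` @source R n)].
Proof.
exists (@of_vec R n); split; first exact: of_vec_identification.
exists (@embed R n); split.
- exact: embed_smooth_embedding.
- exact: embed_isometric.
- exact: embed_equivariant.
- exact: image_variety.
Qed.
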